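(* Let $K$ be a field, $A$ a finite dimensional $K$-algebra, and $\mathcal{T}$ a torsion class in $\mathsf{mod}\,A$. If $\mathcal{T}$ is bicompact and numerically disjoint, then $\mathcal{T}$ is functorially finite.
   Context: $\mathsf{mod}\,A$ is the category of finitely generated $A$-modules and $K_0(\mathsf{mod}\,A)$ its Grothendieck group. A torsion class in $\mathsf{mod}\,A$ is a full subcategory closed under factor modules and extensions (and isomorphisms, containing $0$); a torsion-free class is a full subcategory closed under submodules and extensions. $\mathcal{C}^\perp:=\{X\in\mathsf{mod}\,A\mid \mathrm{Hom}_A(C,X)=0\text{ for all }C\in\mathcal{C}\}$. For $M\in\mathsf{mod}\,A$, $\mathsf{T}(M)$ (resp. $\mathsf{F}(M)$) is the smallest torsion class (resp. torsion-free class) containing $M$. A torsion class $\mathcal{T}$ is compact if $\mathcal{T}=\mathsf{T}(M)$ for some $M\in\mathsf{mod}\,A$; cocompact if $\mathcal{T}^\perp=\mathsf{F}(N)$ for some $N\in\mathsf{mod}\,A$; bicompact if both. A torsion class $\mathcal{T}$ is numerically disjoint if there exist no $X\in\mathcal{T}$ and $Y\in\mathcal{T}^\perp$ such that $[X]=[Y]\neq 0$ in $K_0(\mathsf{mod}\,A)$. An additive full subcategory $\mathcal{C}\subset\mathsf{mod}\,A$ is functorially finite if every $M\in\mathsf{mod}\,A$ admits a left $\mathcal{C}$-approximation (a map $M\to C$, $C\in\mathcal{C}$, through which every map from $M$ to an object of $\mathcal{C}$ factors) and a right $\mathcal{C}$-approximation (dually). *)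

(* Defs.v *)
From HB Require Import structures.
From mathcomp Require Import all_boot all_algebra falgebra.

Set Implicit Arguments.
Unset Strict Implicit.
Unset Printing Implicit Defensive.

Import GRing.Theory.

Local Open Scope ring_scope.

Definition finitely_generated (R : pzRingType) (X : lmodType R) : Prop :=
  exists (n : nat) (v : 'I_n -> X),
    forall x : X, exists a : 'I_n -> R, x = \sum_(i < n) a i *: v i.

(* Modules are left modules; right A-modules are left modules over the
   converse algebra, which is again an arbitrary finite dimensional algebra. *)
Record fgmodType (R : pzRingType) := FgMod {
  fgmod_sort :> lmodType R;
  fgmodP : finitely_generated fgmod_sort
}.

Definition zero_module (R : pzRingType) (X : fgmodType R) : Prop :=
  forall x : X, x = 0.

Definition surjective (S T : Type) (f : S -> T) : Prop :=
  forall y, exists x, f x = y.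

Definition short_exact (R : pzRingType) (X Y Z : fgmodType R)
    (f : {linear X -> Y}) (g : {linear Y -> Z}) : Prop :=
  [/\ injective f, surjective g
    & forall y : Y, g y = 0 <-> exists x : X, f x = y].

Definition isomorphic (R : pzRingType) (X Y : fgmodType R) : Prop :=
  exists f : {linear X -> Y}, bijective f.

(* K_0(mod R) is presented by generators and relations: its elements are
   represented by words in the generators [X], and K0_eq is the congruence
   generated by the laws of abelian groups and by [Y] = [X] + [Z] for every
   short exact sequence 0 -> X -> Y -> Z -> 0.  The quotient is not formed as a
   zmodType: fgmodType R, hence K0_word R, lives in a universe above those of
   the carriers of MathComp structures. *)
Inductive K0_word (R : pzRingType) : Type :=
  | K0_class of fgmodType R
  | K0_zero
  | K0_opp of K0_word R
  | K0_add of K0_word R & K0_word R.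

Arguments K0_zero {R}.

Inductive K0_eq (R : pzRingType) : K0_word R -> K0_word R -> Prop :=
  | K0_refl a : K0_eq a a
  | K0_sym a b : K0_eq a b -> K0_eq b a
  | K0_trans a b c : K0_eq a b -> K0_eq b c -> K0_eq a c
  | K0_opp_congr a b : K0_eq a b -> K0_eq (K0_opp a) (K0_opp b)
  | K0_add_congr a b c d :
      K0_eq a b -> K0_eq c d -> K0_eq (K0_add a c) (K0_add b d)
  | K0_addA a b c : K0_eq (K0_add a (K0_add b c)) (K0_add (K0_add a b) c)
  | K0_addC a b : K0_eq (K0_add a b) (K0_add b a)
  | K0_add0 a : K0_eq (K0_add K0_zero a) a
  | K0_addN a : K0_eq (K0_add (K0_opp a) a) K0_zero
  | K0_exact (X Y Z : fgmodType R) (f : {linear X -> Y}) (g : {linear Y -> Z}) :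
      short_exact f g ->
      K0_eq (K0_class Y) (K0_add (K0_class X) (K0_class Z)).

(* A full subcategory of mod R is given by the predicate of its objects
   (classical_sets.set cannot be used: its universe is below that of
   lmodType R). *)
Definition subcategory (R : pzRingType) := fgmodType R -> Prop.

Section Subcategories.
Variable R : pzRingType.
Implicit Types C T : subcategory R.

Definition contains_zero C : Prop := forall X, zero_module X -> C X.

Definition iso_closed C : Prop := forall X Y, isomorphic X Y -> C X -> C Y.

Definition quotient_closed C : Prop :=
  forall (X Y : fgmodType R) (f : {linear X -> Y}), surjective f -> C X -> C Y.

Definition submodule_closed C : Prop :=
  forall (X Y : fgmodType R) (f : {linear X -> Y}), injective f -> C Y -> C X.

Definition extension_closed C : Prop :=
  forall (X Y Z : fgmodType R) (f : {linear X -> Y}) (g : {linear Y -> Z}),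
    short_exact f g -> C X -> C Z -> C Y.

Definition torsion_class C : Prop :=
  [/\ contains_zero C, iso_closed C, quotient_closed C & extension_closed C].

Definition torsion_free_class C : Prop :=
  [/\ contains_zero C, iso_closed C, submodule_closed C & extension_closed C].

Definition right_perp C : subcategory R := fun Y =>
  forall X : fgmodType R, C X -> forall f : {linear X -> Y}, forall x : X,
    f x = 0.

Definition torsion_gen (M : fgmodType R) : subcategory R := fun X =>
  forall C, torsion_class C -> C M -> C X.

Definition torsion_free_gen (N : fgmodType R) : subcategory R := fun X =>
  forall C, torsion_free_class C -> C N -> C X.

Definition same_objects C D : Prop := forall X, C X <-> D X.

Definition compact_torsion T : Prop :=
  exists M, same_objects T (torsion_gen M).

Definition cocompact_torsion T : Prop :=
  exists N, same_objects (right_perp T) (torsion_free_gen N).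

Definition bicompact_torsion T : Prop :=
  compact_torsion T /\ cocompact_torsion T.

Definition numerically_disjoint T : Prop :=
  ~ exists X Y : fgmodType R,
      [/\ T X, right_perp T Y, K0_eq (K0_class X) (K0_class Y)
        & ~ K0_eq (K0_class X) K0_zero].

Definition left_approximation C (M X : fgmodType R) (f : {linear M -> X}) :
    Prop :=
  C X /\ forall (X' : fgmodType R) (g : {linear M -> X'}), C X' ->
           exists h : {linear X -> X'}, forall m : M, g m = h (f m).

Definition right_approximation C (M X : fgmodType R) (f : {linear X -> M}) :
    Prop :=
  C X /\ forall (X' : fgmodType R) (g : {linear X' -> M}), C X' ->
           exists h : {linear X' -> X}, forall x : X', g x = f (h x).

Definition functorially_finite C : Prop :=
  forall M : fgmodType R,
    (exists (X : fgmodType R) (f : {linear M -> X}), left_approximation C f) /\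
    (exists (X : fgmodType R) (f : {linear X -> M}), right_approximation C f).

End Subcategories.

(* Main.v *)
From HB Require Import structures.
Require Import Defs.
From mathcomp Require Import all_boot all_order all_algebra falgebra.
From mathcomp Require Import boolp mpoly zify ring.

Set Implicit Arguments.
Unset Strict Implicit.
Unset Printing Implicit Defensive.

Import Order.TTheory GRing.Theory Num.Theory VectorInternalTheory.

Local Open Scope ring_scope.

(** Let [T] be the torsion class generated by [M] and let its right orthogonal
    [T^perp] be the torsion-free class cogenerated by [N].

    For an idempotent [e] of [A], the rank [dim e X] is an exact functional of
    [X], and these functionals determine classes in K_0 ([K0_eq_of_ranks]).
    The nonzero quotients of [M] and the nonzero submodules of [N] have finitely
    many rank functions; if the cones that these generate had a common nonzero
    vector, direct sums would give [X] in [T] and [Y] in [T^perp] with the same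
    nonzero class. So by Gordan's alternative numerical disjointness gives an
    integral weight, of the form theta(X) = (sum over j of dim e_j X) - n dim X,
    which is positive on the former modules and negative on the latter
    ([numerical_separation]).

    The weight is the index of maps P1 -> P0 with P1 = A^n and P0 the sum of the
    A e_j, that is, dim Hom(P0, X) - dim Hom(P1, X). Because theta is strictly
    positive, respectively negative, a sufficiently general map between the
    L-th powers of P1 and P0, for L large, makes Hom(P0, M) -> Hom(P1, M)
    surjective and Hom(P0, N) -> Hom(P1, N) injective ([presentation_exists]).
    Over an infinite field this is a count of parameters, the unbounded factor L
    outweighing the dimension of a Grassmannian that does not depend on L. To
    treat all fields at once, the map is taken with indeterminate coefficients,
    the count is done with derivations of the polynomial ring
    ([generic_injective]), and the indeterminates are finally evaluated at
    commuting matrices over the base field, which only enlarges L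
    ([mpoly_unit_eval], [blowup_injective]).

    Surjectivity of Hom(P0, X) -> Hom(P1, X) defines a torsion class
    ([solvable_torsion]) and injectivity a torsion-free class
    ([separated_torsion_free]), so having them on [M] and [N] gives them on all
    of [T] and [T^perp]. A module of [T^perp] with surjectivity has bijectivity,
    hence weight zero, hence is zero; applied to the torsion-free part of [X]
    this shows that [T] consists exactly of the [X] such that every map P1 -> X
    extends to P0. A left approximation of [X] is then the pushout of
    P1^k -> P0^k along a basis of Hom(P1, X) ([left_approximation_exists]); a
    right approximation is the inclusion of the torsion part. *)

(** * Evaluating polynomials at commuting matrices *)

Lemma digits_inj (B n : nat) (a b : 'I_n -> nat) :
  (forall i, a i < B)%N -> (forall i, b i < B)%N ->
  (\sum_(i < n) a i * B ^ i = \sum_(i < n) b i * B ^ i)%N -> a =1 b.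
Proof.
elim: n a b => [|n IH] a b ltaB ltbB; first by move=> _ [].
have tailE c : (\sum_(i < n.+1) c i * B ^ i)%N =
    (\sum_(i < n) c (lift ord0 i) * B ^ i * B + c ord0)%N.
  rewrite big_ord_recl expn0 muln1 addnC; congr (_ + _)%N.
  by apply: eq_bigr => i _; rewrite expnSr mulnA.
rewrite !tailE -!big_distrl /= => eq_ab.
have B_gt0 : (0 < B)%N by apply: leq_ltn_trans (ltaB ord0).
have eq0 : a ord0 = b ord0.
  by move/(congr1 (modn^~ B)): eq_ab; rewrite !modnMDl !modn_small.
have eqS : forall i, a (lift ord0 i) = b (lift ord0 i).
  apply: IH => //.
  by move: eq_ab; rewrite eq0 => /addIn /eqP; rewrite eqn_pmul2r // => /eqP.
by move=> i; case: (unliftP ord0 i) => [j|] ->.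
Qed.

(** Kronecker substitution: sending the i-th variable to X^(B^i), with B above
    every exponent of p, separates the monomials of p. *)
Lemma kronecker_neq0 (K : fieldType) (n : nat) (p : {mpoly K[n]}) :
  p != 0 -> exists h : 'I_n -> {poly K}, mmap (@polyC K) h p != 0.
Proof.
move=> p_neq0; pose B := (\max_(m <- msupp p) \max_(i < n) (m i).+1)%N.
pose h (i : 'I_n) : {poly K} := 'X^(B ^ i).
exists h; pose code (m : 'X_{1..n}) := (\sum_(i < n) m i * B ^ i)%N.
have ltB m : m \in msupp p -> forall i, (m i < B)%N.
  move=> mp i; rewrite /B (big_rem m) //= leq_max.
  by rewrite (leq_bigmax (F := fun i => (m i).+1)).
have codeE m : mmap1 h m = 'X^(code m).
  rewrite /mmap1 /h /code; elim/big_rec2: _ => [|i y1 y2 _ ->].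
    by rewrite expr0.
  by rewrite exprD -exprM mulnC.
case: (boolP (msupp p == [::])) => [|]; first by rewrite msupp_eq0 (negPf p_neq0).
case Ep: (msupp p) => [//|m0 s] _.
have m0p : m0 \in msupp p by rewrite Ep mem_head.
have : (mmap (@polyC K) h p)`_(code m0) = p@_m0.
  rewrite /mmap coef_sum (bigD1_seq m0) ?msupp_uniq //= big1_seq => [|m].
    by rewrite addr0 codeE coefCM coefXn eqxx mulr1.
  case/andP=> neq_m mp; rewrite codeE coefCM coefXn; case: eqP => [eqc|].
    case/eqP: neq_m; apply/mnmP.
    by apply: (digits_inj (ltB m mp) (ltB m0 m0p)).
  by rewrite mulr0.
move=> coef_p; apply/eqP=> mmap0; move: m0p.
by rewrite mcoeff_msupp -coef_p mmap0 coef0 eqxx.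
Qed.

(** Take for C the companion matrix of a monic multiple of 1 + X p: by
    Cayley-Hamilton 1 + C p(C) = 0, so - C inverts p(C). *)
Lemma horner_mx_unit (K : fieldType) (p : {poly K}) :
  p != 0 -> exists (m : nat) (C : 'M[K]_m.+1), horner_mx C p \in unitmx.
Proof.
move=> p_neq0; pose q := 'X * p + 1.
have sz_q : size q = (size p).+1.
  rewrite size_polyDl ?size_mul ?polyX_eq0 ?size_polyX //.
  by rewrite size_poly1 ltnS size_poly_gt0.
pose g := (lead_coef q)^-1 *: q.
have lq : lead_coef q != 0 by rewrite lead_coef_eq0 -size_poly_gt0 sz_q.
have g_monic : g \is monic by rewrite monicE lead_coefZ mulVf.
have sz_g : size g = (size p).+1 by rewrite size_scale ?sz_q // invr_eq0.
have [m sz_p] : exists m, size p = m.+1.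
  by exists (size p).-1; rewrite prednK // size_poly_gt0.
have [C charC] : exists C : 'M[K]_m.+1, char_poly C = g.
  have := companionmxK g_monic; move: (companionmx g).
  by rewrite sz_g sz_p /= => C <-; exists C.
exists m, C.
have : horner_mx C g = 0 by rewrite -charC Cayley_Hamilton.
rewrite /g linearZ /= => /(congr1 (fun M => lead_coef q *: M)).
rewrite scalerA divff // scale1r scaler0 rmorphD rmorph1 rmorphM /=.
rewrite horner_mx_X => /eqP; rewrite addr_eq0 => /eqP Cp.
have : (- C) *m horner_mx C p = 1%:M by rewrite mulNmx [_ *m _]Cp opprK.
by case/mulmx1_unit.
Qed.

(** Substitute for evaluation at a point where p does not vanish, valid over
    finite fields too. The second morphism is the same evaluation at the
    transposed matrix; it serves the dual family in the blow-up theorem. *)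
Lemma mpoly_unit_eval (K : fieldType) (n : nat) (p : {mpoly K[n]}) :
  p != 0 ->
  exists (m : nat) (phi psi : {rmorphism {mpoly K[n]} -> 'M[K]_m.+1}),
    [/\ forall c : K, phi c%:MP = c%:M, forall q, psi q = (phi q)^T
      & phi p \in unitmx].
Proof.
case/kronecker_neq0=> h /horner_mx_unit [m] [C unitC].
exists m, (horner_mx C \o mmap (@polyC K) h).
exists (horner_mx C^T \o mmap (@polyC K) h); split=> //= [c|q].
  by rewrite mmapC horner_mx_C.
elim/poly_ind: (mmap _ _ _) => [|r c IH]; first by rewrite !rmorph0 trmx0.
rewrite !rmorphD !rmorphM /= !horner_mx_X !horner_mx_C raddfD /= IH.
rewrite tr_scalar_mx -[_ * C^T]/(_ *m _) -trmx_mul; congr (_^T + _).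
by rewrite [RHS](comm_horner_mx r (comm_mx_refl C)).
Qed.

(** * Expanding families of linear maps *)

Lemma linear_hom (K : fieldType) (V W : vectType K) (f : V -> W) :
  linear f -> exists F : 'Hom(V, W), forall x, F x = f x.
Proof.
move=> f_lin; pose fL := GRing.isLinear.Build K V W _ f f_lin.
pose F : {linear V -> W} := HB.pack f fL.
by exists (linfun F) => x; rewrite lfunE.
Qed.

Lemma dimvM (K : fieldType) (m n : nat) : \dim {:'M[K]_(m, n)} = (m * n)%N.
Proof. by rewrite dimvf dim_matrix. Qed.

Lemma dim_limg_sub (K : fieldType) (V W : vectType K) (f : 'Hom(V, W))
    (U : {vspace V}) :
  (\dim (limg f) + \dim U <= \dim {:V} + \dim (f @: U))%N.
Proof.
have := limg_ker_dim f U; have := limg_ker_dim f fullv; rewrite capfv.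
have := dimvS (capvSr U (lker f)); lia.
Qed.

Lemma lker_neq0 (K : fieldType) (V W : vectType K) (f : 'Hom(V, W)) :
  (\dim {:W} < \dim {:V})%N -> lker f != 0%VS.
Proof.
move=> ltWV; apply/eqP => kf; have := limg_ker_dim f fullv; rewrite capfv kf dimv0.
by have := dimvS (subvf (limg f)); lia.
Qed.

(** The linear-algebra form of strict positivity of a weight: every nonzero
    subspace grows strictly under the family. *)
Definition expanding (K : fieldType) (V W : vectType K) (I : finType)
    (h : I -> 'Hom(V, W)) : Prop :=
  forall S : {vspace V}, S != 0%VS -> (\dim S < \dim (\sum_i h i @: S)%VS)%N.

Lemma expanding_leq (K : fieldType) (V W : vectType K) (I : finType)
    (h : I -> 'Hom(V, W)) (S : {vspace V}) :
  expanding h -> (\dim S <= \dim (\sum_i h i @: S)%VS)%N.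
Proof.
move=> exp_h; have [->|/exp_h/ltnW//] := eqVneq S 0%VS.
by rewrite dimv0.
Qed.

(** Dimensions of S and of its image split along the exact sequences V0 -> V
    -> V1 and W0 -> W -> W1. *)
Lemma expanding_ext (K : fieldType) (V0 V V1 W0 W W1 : vectType K) (I : finType)
    (h0 : I -> 'Hom(V0, W0)) (h : I -> 'Hom(V, W)) (h1 : I -> 'Hom(V1, W1))
    (g : 'Hom(V0, V)) (f : 'Hom(V, V1)) (g' : 'Hom(W0, W)) (f' : 'Hom(W, W1)) :
  lker g = 0%VS -> limg g = lker f -> lker g' = 0%VS -> (f' \o g' = 0)%VF ->
  (forall i, h i \o g = g' \o h0 i)%VF -> (forall i, f' \o h i = h1 i \o f)%VF ->
  expanding h0 -> expanding h1 -> expanding h.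
Proof.
move=> kg imf kg' fg' hg fh exp0 exp1 S S_neq0.
pose S1 := (f @: S)%VS; pose S0 := (g @^-1: S)%VS.
have gS0 : (g @: S0)%VS = (S :&: lker f)%VS.
  by rewrite -[S0]lpreim_cap_limg imf lpreimK // imf capvSr.
have dimS0 : \dim (S :&: lker f) = \dim S0.
  by rewrite -gS0 limg_dim_eq // kg capv0.
rewrite -(limg_ker_dim f S) -(limg_ker_dim f' (\sum_i _)%VS) dimS0.
have imHS : (f' @: (\sum_i h i @: S))%VS = (\sum_i h1 i @: S1)%VS.
  by rewrite limg_sum; apply: eq_bigr => i _; rewrite -!limg_comp fh.
have dimHS0 : (\dim (\sum_i h0 i @: S0)
    <= \dim ((\sum_i h i @: S) :&: lker f'))%N.
  have <- : \dim (g' @: (\sum_i h0 i @: S0)) = \dim (\sum_i h0 i @: S0).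
    by rewrite limg_dim_eq // kg' capv0.
  apply: dimvS; rewrite subv_cap; apply/andP; split.
    rewrite limg_sum; apply/subv_sumP => i _; rewrite -limg_comp -hg limg_comp.
    apply: subv_trans (sumv_sup i _ (subvv _)) => //.
    by rewrite limgS // gS0 capvSl.
  by rewrite lkerE -limg_comp fg' -subv0; apply/subvP => _ /memv_imgP [u _ ->];
    rewrite lfunE /= mem0v.
rewrite imHS -[(f @: S)%VS]/S1.
have [S0_0|S0_neq0] := eqVneq S0 0%VS; last first.
  rewrite -addSn leq_add //; last exact: expanding_leq.
  exact: leq_trans (exp0 _ S0_neq0) dimHS0.
have S1_neq0 : S1 != 0%VS.
  rewrite -dimv_eq0; have := limg_ker_dim f S; rewrite dimS0 S0_0 dimv0 add0n => ->.
  by rewrite dimv_eq0.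
rewrite -addnS leq_add ?exp1 //.
exact: leq_trans (expanding_leq _ exp0) dimHS0.
Qed.

Definition rmul (K : fieldType) (m d e : nat) (h : 'M[K]_(d, e)) :
  'Hom('M[K]_(m, d), 'M[K]_(m, e)) := linfun (mulmxr h).

Lemma rmulE (K : fieldType) (m d e : nat) (h : 'M[K]_(d, e)) (x : 'M[K]_(m, d)) :
  rmul m h x = x *m h.
Proof. by rewrite lfunE. Qed.

(** Rows are peeled off one at a time; this makes the hypothesis on row
    vectors apply to m copies of the space, hence to subspaces obtained by
    evaluating at m x m matrices. *)
Lemma expanding_amplify (K : fieldType) (I : finType) (d e : nat)
    (h : I -> 'M[K]_(d, e)) (m : nat) :
  expanding (fun i => rmul 1 (h i)) -> expanding (fun i => rmul m (h i)).
Proof.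
move=> exp_h; elim: m => [|m IHm].
  move=> S; rewrite -subv0 => /subvPn [x _]; by rewrite flatmx0 mem0v.
pose g p : 'Hom('M[K]_(m, p), 'M[K]_(1 + m, p)) := 
  linfun (mulmx (col_mx 0 1%:M)).
pose f p : 'Hom('M[K]_(1 + m, p), 'rV[K]_p) := linfun (@usubmx _ 1 m p).
have gE p x : g p x = col_mx 0 x.
  by rewrite lfunE /= mul_col_mx mul0mx mul1mx.
have fE p x : f p x = usubmx x by rewrite lfunE.
have kg p : lker (g p) = 0%VS.
  apply/eqP/lker0P => x y; rewrite !gE => /eq_col_mx [].
  by [].
apply: (expanding_ext (g := g d) (f := f d) (g' := g e) (f' := f e)
  _ _ _ _ _ _ IHm exp_h).
- exact: kg.
- apply/vspaceP => x; rewrite memv_ker fE; apply/memv_imgP/eqP => [[y _ ->]|x0].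
    by rewrite gE col_mxKu.
  by exists (dsubmx x); rewrite ?memvf // gE -x0 vsubmxK.
- exact: kg.
- by apply/lfunP => x; rewrite comp_lfunE gE fE col_mxKu lfunE.
- move=> i; apply/lfunP => x; rewrite !comp_lfunE !gE !rmulE.
  by rewrite mul_col_mx mul0mx.
- by move=> i; apply/lfunP => x; rewrite !comp_lfunE !fE !rmulE mul_usub_mx.
Qed.

(** * Expansion persists after evaluating indeterminates *)

Lemma fraction_div (R : idomainType) (x : {fraction R}) :
  exists n d : R, d != 0 /\ tofrac d * x = tofrac n.
Proof.
elim/quotW: x => x; exists \n_x, \d_x; split; first exact: denom_ratioP.
unlock tofrac; rewrite -[LHS]FracField.pi_mul; apply/eqmodP.
rewrite /= FracField.equivfE /FracField.mulf.
by rewrite !numden_Ratio ?oner_eq0 ?mul1r ?mulr1 ?denom_ratioP // mulrC.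
Qed.

Section Fractions.
Variables (R : idomainType) (Q : fieldType) (j : {rmorphism R -> Q}).
Hypothesis j_inj : injective j.
Hypothesis j_frac : forall x : Q, exists n d : R, d != 0 /\ j d * x = j n.

Lemma common_denominator (I : finType) (x : I -> Q) :
  exists d (n : I -> R), d != 0 /\ forall i, j (n i) = j d * x i.
Proof.
have [n /choice [d nd]] := choice (fun i => j_frac (x i)).
exists (\prod_i d i), (fun i => \prod_(k | k != i) d k * n i); split.
  by apply/prodf_neq0 => i _; case: (nd i).
move=> i; have [_ dx] := nd i.
rewrite rmorphM -dx mulrA -rmorphM [in RHS](bigD1 i) //=.
by rewrite (mulrC (d i)).
Qed.

Lemma clear_denominators (a b : nat) (X : 'M[Q]_(a, b)) :
  exists d (Y : 'M[R]_(a, b)), d != 0 /\ map_mx j Y = j d *: X.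
Proof.
have [d [n [d0 nE]]] := common_denominator (fun ik : 'I_a * 'I_b => X ik.1 ik.2).
exists d, (\matrix_(i, k) n (i, k)); split=> //.
by apply/matrixP=> i k; rewrite !mxE nE.
Qed.

Lemma map_mx_frac_inj (a b : nat) : injective (fun X : 'M[R]_(a, b) => map_mx j X).
Proof.
move=> X Y /matrixP eqXY; apply/matrixP=> i k.
by apply: j_inj; have := eqXY i k; rewrite !mxE.
Qed.

(** A one-sided inverse over the fraction field with its denominators cleared
    survives any evaluation of the indeterminates. *)
Lemma frac_row_freeP (a b : nat) (X : 'M[R]_(a, b)) :
  row_free (map_mx j X) -> exists d (Y : 'M[R]_(b, a)), d != 0 /\ X *m Y = d%:M.
Proof.
case/row_freeP=> Z XZ; have [d [Y [d0 YE]]] := clear_denominators Z.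
exists d, Y; split=> //; apply: map_mx_frac_inj.
by rewrite map_mxM YE -scalemxAr XZ map_scalar_mx scalemx1.
Qed.

End Fractions.

Section Evaluation.
Variables (K : fieldType) (R : comNzRingType) (iota : {rmorphism K -> R}).
Variables (m : nat) (phi : {rmorphism R -> 'M[K]_m.+1}).
Hypothesis phi_iota : forall c, phi (iota c) = c%:M.

(** The image of a matrix over R under phi acts blockwise on tuples of column
    vectors of size m+1, stored as the columns of a matrix; phi has commuting
    values, so this is a right action. *)
Definition evalmx (a b : nat) (X : 'M[R]_(a, b)) (x : 'M[K]_(m.+1, a)) :
    'M[K]_(m.+1, b) :=
  \matrix_(p, c) \sum_k (phi (X k c) *m x) p k.

Lemma evalmx_linear a b (X : 'M[R]_(a, b)) : linear (evalmx X).
Proof.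
move=> u x y; apply/matrixP=> p c; rewrite !mxE big_distrr -big_split /=.
apply: eq_bigr => k _; rewrite mulmxDr -scalemxAr.
by rewrite [LHS]mxE [X in X + _]mxE.
Qed.

HB.instance Definition _ a b X := GRing.isLinear.Build K 'M[K]_(m.+1, a)
  'M[K]_(m.+1, b) _ (@evalmx a b X) (@evalmx_linear a b X).

Lemma evalmxM a b c (X : 'M[R]_(a, b)) (Y : 'M[R]_(b, c)) x :
  evalmx (X *m Y) x = evalmx Y (evalmx X x).
Proof.
apply/matrixP=> p t; rewrite [LHS]mxE [RHS]mxE.
transitivity (\sum_k \sum_l (phi (Y l t) *m phi (X k l) *m x) p k).
  apply: eq_bigr => k _; rewrite [in phi _]mxE rmorph_sum mulmx_suml summxE.
  by apply: eq_bigr => l _; rewrite mulrC rmorphM.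
rewrite exchange_big; apply: eq_bigr => l _ /=.
rewrite mxE; under [RHS]eq_bigr => q _ do rewrite mxE big_distrr.
rewrite exchange_big; apply: eq_bigr => k _ /=.
by rewrite -mulmxA mxE.
Qed.

Lemma evalmx_scale a b d (X : 'M[R]_(a, b)) x :
  evalmx (d *: X) x = evalmx X (phi d *m x).
Proof.
apply/matrixP=> p t; rewrite [LHS]mxE [RHS]mxE; apply: eq_bigr => k _.
by rewrite [in phi _]mxE mulrC rmorphM mulmxA.
Qed.

Lemma evalmx_map a b (h : 'M[K]_(a, b)) x : evalmx (map_mx iota h) x = x *m h.
Proof.
apply/matrixP=> p t; rewrite [LHS]mxE [RHS]mxE; apply: eq_bigr => k _.
by rewrite [in phi _]mxE phi_iota mul_scalar_mx mxE mulrC.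
Qed.

Lemma evalmx_scalar a d (x : 'M[K]_(m.+1, a)) : evalmx d%:M x = phi d *m x.
Proof.
rewrite -scalemx1 evalmx_scale.
have -> : (1%:M : 'M[R]_a) = map_mx iota 1%:M by rewrite map_scalar_mx rmorph1.
by rewrite evalmx_map mulmx1.
Qed.

(** After evaluation the rows of N span a subspace of dimension s(m+1),
    because N P = a and phi a is invertible, while its image under the family
    lies in the span of the rows of D, of dimension at most r(m+1). *)
Lemma expanding_evalmx (I : finType) (s d e r : nat) (h : I -> 'M[K]_(d, e))
    (N : 'M[R]_(s, d)) (P : 'M[R]_(d, s)) (C : I -> 'M[R]_(s, r))
    (D : 'M[R]_(r, e)) (a b : R) :
  expanding (fun i => rmul m.+1 (h i)) -> N *m P = a%:M ->
  (forall i, b *: (N *m map_mx iota (h i)) = C i *m D) ->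
  phi a \in unitmx -> phi b \in unitmx -> (0 < s)%N -> (s < r)%N.
Proof.
move=> exp_h NP CD phi_a phi_b s_gt0.
pose f := linfun (evalmx N).
have kf : lker f == 0%VS.
  apply/lker0P => x y; rewrite !lfunE => /= eq_xy.
  by apply: (can_inj (mulKmx phi_a)); rewrite -!evalmx_scalar -NP !evalmxM eq_xy.
have dim_f : \dim (limg f) = (m.+1 * s)%N.
  rewrite limg_dim_eq; first by rewrite dimvM.
  by rewrite (eqP kf) capv0.
have : limg f != 0%VS by rewrite -dimv_eq0 dim_f -lt0n muln_gt0.
move/exp_h; rewrite dim_f => lt_s.
suff le_r : (\dim (\sum_i rmul m.+1 (h i) @: limg f) <= m.+1 * r)%N.
  by have := leq_trans lt_s le_r; rewrite ltn_pmul2l.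
apply: (@leq_trans (\dim (limg (linfun (evalmx D))))); last first.
  apply: leq_trans (_ : \dim (fullv : {vspace 'M[K]_(m.+1, r)}) <= _)%N.
    by rewrite -(limg_ker_dim (linfun (evalmx D))) leq_addl.
  by rewrite dimvM.
apply/dimvS/subv_sumP => i _; apply/subvP => _ /memv_imgP [_ /memv_imgP [x _ ->] ->].
rewrite rmulE lfunE /=; apply/memv_imgP.
exists (evalmx (C i) (invmx (phi b) *m x)); first exact: memvf.
by rewrite lfunE /= -evalmxM -CD evalmx_scale mulKVmx // evalmxM evalmx_map.
Qed.

End Evaluation.

(** * A generic combination of an expanding family is injective *)

Section Generic.
Variables (R : idomainType) (Q : fieldType) (j : {rmorphism R -> Q}).
Hypothesis j_inj : injective j.
Hypothesis j_frac : forall x : Q, exists n d : R, d != 0 /\ j d * x = j n.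
Variables (I : finType) (l d e : nat).
Variables (T : I -> 'M[R]_l) (h : I -> 'M[R]_(d, e)).
Local Notation directions := {ffun I -> 'M[Q]_l}.
Variable D : directions -> R -> Q.
Hypothesis D_linear : forall x a c c', D (a *: c + c') x = a * D c x + D c' x.
Hypothesis DD : forall c x y, D c (x + y) = D c x + D c y.
Hypothesis DM : forall c x y, D c (x * y) = D c x * j y + j x * D c y.
Hypothesis D_T : forall c i p q, D c (T i p q) = c i p q.
Hypothesis D_h : forall c i p q, D c (h i p q) = 0.

Let D0 c : D c 0 = 0.
Proof. by apply: (addrI (D c 0)); rewrite -DD !addr0. Qed.

Let Dsum c (J : Type) (r : seq J) (F : J -> R) :
  D c (\sum_(k <- r) F k) = \sum_(k <- r) D c (F k).
Proof. by elim/big_rec2: _ => [//|k y1 y2 _ <-]; rewrite DD. Qed.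

Let DmxM c (m n p : nat) (X : 'M[R]_(m, n)) (Y : 'M[R]_(n, p)) :
  map_mx (D c) (X *m Y) =
  map_mx (D c) X *m map_mx j Y + map_mx j X *m map_mx (D c) Y.
Proof.
apply/matrixP=> u v; rewrite !mxE Dsum -big_split /=; apply: eq_bigr => k _.
by rewrite DM !mxE.
Qed.

Let Dmx_h c i : map_mx (D c) (h i) = 0.
Proof. by apply/matrixP=> u v; rewrite !mxE D_h. Qed.

Let Dmx_T c i : map_mx (D c) (T i) = c i.
Proof. by apply/matrixP=> u v; rewrite !mxE D_T. Qed.

Let Dmx_linear (m n : nat) (X : 'M[R]_(m, n)) :
  linear (fun c => map_mx (D c) X).
Proof. by move=> a c c'; apply/matrixP=> u v; rewrite !mxE D_linear. Qed.

(** This is the dimension count for the incidence variety of pairs (T, k) with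
    sum_i T_i k h_i = 0, carried out with derivations so that it is valid over
    any field. Write k = U N with N of full row rank s. Directions c along
    which the row space of N does not move have codimension at most s d.
    Differentiating the relation along such c expresses sum_i c_i k h_i as a
    value of the map Z |-> sum_i T_i Z N h_i, whose kernel contains U; that
    leaves at most l s - 1 dimensions. But over all c the sums sum_i c_i k h_i
    fill a space of dimension at least l (s + 1), which is too much once l >=
    d^2. *)
Lemma generic_injective (k : 'M[Q]_(l, d)) :
  (forall s (N : 'M[R]_(s, d)), (0 < s)%N -> row_free (map_mx j N) ->
     (s < \rank (\sum_i <<map_mx j (N *m h i)>>)%MS)%N) ->
  (d * d <= l)%N ->
  \sum_i map_mx j (T i) *m k *m map_mx j (h i) = 0 -> k = 0.
Proof.
move=> exp_h le_l Tk0; apply/eqP; apply: contraT => k_neq0; exfalso.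
have [a [U [a0 UE]]] := clear_denominators j_frac (col_base k).
have [b [N [b0 NE]]] := clear_denominators j_frac (row_base k).
move: U UE N NE; set s := \rank k => U UE N NE.
have s_gt0 : (0 < s)%N by rewrite /s lt0n mxrank_eq0.
have ja0 : j a != 0 by rewrite -(rmorph0 j) (inj_eq j_inj).
have jb0 : j b != 0 by rewrite -(rmorph0 j) (inj_eq j_inj).
have N_free : row_free (map_mx j N).
  by rewrite NE /row_free mxrank_scale_nz // -/(row_free _) row_base_free.
have U_full : row_full (map_mx j U).
  by rewrite UE /row_full mxrank_scale_nz // -/(row_full _) col_base_full.
have rel : \sum_i T i *m (U *m N) *m h i = 0.
  apply: (map_mx_frac_inj j_inj); rewrite /= raddf_sum /= map_mx0.
  transitivity ((j a * j b) *: (\sum_i map_mx j (T i) *m k *m map_mx j (h i))).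
    rewrite scaler_sumr; apply: eq_bigr => i _.
    rewrite -[in RHS](mulmx_base k) !map_mxM UE NE -!(scalemxAl, scalemxAr).
    by rewrite scalerA mulrC.
  by rewrite Tk0 scaler0.
set W := (\sum_i <<map_mx j (N *m h i)>>)%MS in exp_h *.
have lt_s : (s < \rank W)%N by apply: exp_h.
(* directions in which the row space of N does not move *)
have ker_lin : linear (fun c : directions => map_mx (D c) N *m cokermx (map_mx j N)).
  by move=> x c c'; rewrite Dmx_linear mulmxDl scalemxAl.
have [kerF kerFE] := linear_hom ker_lin; pose X0 := lker kerF.
have G_lin : linear (fun c : directions =>
    \sum_i c i *m map_mx j (U *m N) *m map_mx j (h i)).
  move=> x c c'; rewrite scaler_sumr -big_split /=; apply: eq_bigr => i _.
  by rewrite !ffunE !mulmxDl -!scalemxAl.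
have [G GE] := linear_hom G_lin.
have g_lin : linear (fun Z : 'M[Q]_(l, s) =>
    \sum_i map_mx j (T i) *m (Z *m map_mx j N) *m map_mx j (h i)).
  move=> x c c'; rewrite scaler_sumr -big_split /=; apply: eq_bigr => i _.
  by rewrite !(mulmxDl, mulmxDr) -!(scalemxAl, scalemxAr) -?scalemxAl.
have [g gE] := linear_hom g_lin.
have GX0 : (G @: X0 <= limg g)%VS.
  apply/subvP => _ /memv_imgP [c c_X0 ->].
  have /eqP cN0 : map_mx (D c) N *m cokermx (map_mx j N) == 0.
    by rewrite -kerFE -memv_ker.
  have [Z DN] : exists Z, map_mx (D c) N = Z *m map_mx j N.
    by apply/submxP; rewrite submxE cN0.
  apply/memv_imgP; exists (- (map_mx (D c) U + map_mx j U *m Z)).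
    exact: memvf.
  rewrite GE gE; apply/eqP; rewrite -subr_eq0 -sumrB.
  have := congr1 (map_mx (D c)) rel; rewrite -[X in _ = X -> _]/(map_mx (D c) 0).
  have -> : map_mx (D c) (0 : 'M[R]_(l, e)) = 0.
    by apply/matrixP=> u v; rewrite !mxE D0.
  have -> : map_mx (D c) (\sum_i T i *m (U *m N) *m h i) =
      \sum_i map_mx (D c) (T i *m (U *m N) *m h i).
    by apply/matrixP=> u v; rewrite !mxE !summxE Dsum; apply: eq_bigr => i _;
      rewrite !mxE.
  move=> rel'; apply/eqP; rewrite -[RHS]rel'; apply: eq_bigr => i _.
  rewrite !DmxM Dmx_h Dmx_T mulmx0 addr0 mulmxDl DN; congr (_ *m _ *m _ + _).
  by rewrite mulNmx mulmxN mulNmx opprK !mulmxDl mulmxA.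
have dim_g : (\dim (limg g) < l * s)%N.
  rewrite -(dimvM Q) -(limg_ker_dim g fullv) capfv -[X in (X < _)%N]add0n.
  rewrite ltn_add2r lt0n dimv_eq0 -subv0; apply/negP=> /subvP /(_ (map_mx j U)).
  rewrite memv_ker gE memv0.
  have -> : \sum_i map_mx j (T i) *m (map_mx j U *m map_mx j N) *m map_mx j (h i)
      = map_mx j (\sum_i T i *m (U *m N) *m h i).
    by rewrite raddf_sum; apply: eq_bigr => i _; rewrite /= !map_mxM.
  rewrite rel map_mx0 => /(_ (eqxx _)) /eqP U0; move: U_full.
  by rewrite U0 /row_full mxrank0 eq_sym gtn_eqF.
have dim_G : (l * \rank W <= \dim (limg G))%N.
  pose f := rmul l (row_base W).
  have dim_f : \dim (limg f) = (l * \rank W)%N.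
    rewrite limg_dim_eq ?dimvM //; apply/eqP; rewrite -subv0.
    apply/subvP => x; rewrite memv_cap memvf memv_ker rmulE /= => /eqP x0.
    rewrite memv0; apply/eqP/(row_free_inj (row_base_free W)).
    by rewrite /= x0 mul0mx.
  rewrite -dim_f; apply/dimvS/subvP => _ /memv_imgP [Z _ ->]; rewrite rmulE.
  have : (Z *m row_base W <= \sum_i <<map_mx j (U *m N *m h i)>>)%MS.
    apply: (submx_trans (submxMl _ _)); rewrite eq_row_base.
    apply/sumsmx_subP => i _; apply: (sumsmx_sup i) => //.
    by rewrite !genmxE -mulmxA [X in (_ <= X)%MS]map_mxM (eqmxMfull _ U_full).
  case/sub_sums_genmxP => u ->; apply/memv_imgP.
  exists [ffun i => u i]; first exact: memvf.
  by rewrite GE; apply: eq_bigr => i _; rewrite ffunE map_mxM mulmxA.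
have dim_X0 : (\dim (fullv : {vspace directions}) <= \dim X0 + s * d)%N.
  rewrite -(limg_ker_dim kerF fullv) capfv leq_add2l.
  by rewrite -(dimvM Q) dimvS ?subvf.
have dim_GX0 := dim_limg_sub G X0.
have le_sd : (s <= d)%N by rewrite /s rank_leq_col.
have dim_GX0_g := leq_ltn_trans (dimvS GX0) dim_g.
move: dim_GX0 dim_X0; set x := \dim fullv; set y := \dim (limg G).
set z := \dim X0; set t := \dim (G @: X0) => dim_GX0 dim_X0.
have : (l * s.+1 <= l * \rank W)%N by rewrite leq_mul2l lt_s orbT.
have : (s * d <= l)%N by apply: leq_trans le_l; rewrite leq_mul2r le_sd orbT.
move: dim_G dim_GX0_g; rewrite -/y -/t; lia.
Qed.
End Generic.

(** * From indeterminates to block matrices *)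

Definition sandwich (R : comNzRingType) (I : finType) (l d e : nat)
    (T : I -> 'M[R]_l) (h : I -> 'M[R]_(d, e)) : 'M[R]_(l * d, l * e) :=
  \sum_i lin_mulmx (T i) *m lin_mulmxr (h i).

Lemma sandwichE (R : comNzRingType) (I : finType) (l d e : nat)
    (T : I -> 'M[R]_l) (h : I -> 'M[R]_(d, e)) (k : 'M[R]_(l, d)) :
  mxvec k *m sandwich T h = mxvec (\sum_i T i *m k *m h i).
Proof.
rewrite /sandwich mulmx_sumr linear_sum; apply: eq_bigr => i _ /=.
by rewrite mulmxA !mul_vec_lin.
Qed.

Lemma map_sandwich (R S : comNzRingType) (f : {rmorphism R -> S}) (I : finType)
    (l d e : nat) (T : I -> 'M[R]_l) (h : I -> 'M[R]_(d, e)) :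
  map_mx f (sandwich T h) =
  sandwich (fun i => map_mx f (T i)) (fun i => map_mx f (h i)).
Proof.
rewrite /sandwich raddf_sum; apply: eq_bigr => i _ /=; rewrite map_mxM.
by congr (_ *m _); apply: map_lin_mx => A; rewrite /= map_mxM.
Qed.

Definition unmxvec (m n : nat) (k : 'I_(m * n)) : 'I_m * 'I_n :=
  enum_val (cast_ord (esym (mxvec_cast m n)) k).

Lemma unmxvecK m n (i : 'I_m) (j : 'I_n) : unmxvec (mxvec_index i j) = (i, j).
Proof. by rewrite /unmxvec /mxvec_index cast_ordK enum_rankK. Qed.

Lemma lin_mx_entry (R : comNzRingType) (m1 n1 m2 n2 : nat)
    (f : {linear 'M[R]_(m1, n1) -> 'M[R]_(m2, n2)}) i j k l :
  lin_mx f (mxvec_index i j) (mxvec_index k l) = f (delta_mx i j) k l.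
Proof. by rewrite mxE /= vec_mx_delta mxvecE. Qed.

Lemma lin_mulmx_entry (R : comNzRingType) (m n p : nat) (A : 'M[R]_(m, n)) i
    (j j' : 'I_p) k :
  lin_mulmx A (mxvec_index i j) (mxvec_index k j') = A k i *+ (j == j').
Proof.
rewrite lin_mx_entry mxE (bigD1 i) //= big1 ?addr0 => [|s neq_s].
  by rewrite mxE eqxx eq_sym mulr_natr.
by rewrite mxE (negPf neq_s) mulr0.
Qed.

Lemma lin_mulmxr_entry (R : comNzRingType) (m n p : nat) (A : 'M[R]_(n, p))
    (i i' : 'I_m) j k :
  lin_mulmxr A (mxvec_index i j) (mxvec_index i' k) = A j k *+ (i == i').
Proof.
rewrite lin_mx_entry mxE (bigD1 j) //= big1 ?addr0 => [|s neq_s].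
  by rewrite mxE eqxx andbT eq_sym mulr_natl.
by rewrite mxE (negPf neq_s) andbF mul0r.
Qed.

Lemma sum_mxvec (V : nmodType) m n (F : 'I_(m * n) -> V) :
  \sum_k F k = \sum_i \sum_j F (mxvec_index i j).
Proof.
rewrite (reindex _ (curry_mxvec_bij m n)) /= pair_bigA /=.
by apply: eq_bigr => -[].
Qed.

Section Blowup.
Variables (K : fieldType) (R : comNzRingType) (iota : {rmorphism K -> R}).
Variables (m : nat) (phi : {rmorphism R -> 'M[K]_m.+1}).
Hypothesis phi_iota : forall c, phi (iota c) = c%:M.

Definition blowmx (l : nat) (T : 'M[R]_l) : 'M[K]_(l * m.+1) :=
  \matrix_(u, v) phi (T (unmxvec u).1 (unmxvec v).1) (unmxvec u).2 (unmxvec v).2.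

(** Reindexing of a block column into the format on which evalmx acts. *)
Definition spread (l d : nat) (k : 'M[K]_(l * m.+1, d)) : 'M[K]_(m.+1, l * d) :=
  \matrix_(q, v) k (mxvec_index (unmxvec v).1 q) (unmxvec v).2.

Lemma spread_inj l d : injective (@spread l d).
Proof.
move=> k k' /matrixP eq_k; apply/matrixP => u t.
case/mxvec_indexP: u => p q; have := eq_k q (mxvec_index p t).
by rewrite !mxE unmxvecK.
Qed.

Lemma evalmx_lin_mulmx l d (T : 'M[R]_l) (k : 'M[K]_(l * m.+1, d)) :
  evalmx phi (lin_mulmx T) (spread k) = spread (blowmx T *m k).
Proof.
apply/matrixP => q v; case/mxvec_indexP: v => p t.
rewrite [LHS]mxE [RHS]mxE unmxvecK /= [RHS]mxE !sum_mxvec.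
apply: eq_bigr => p' _; rewrite (bigD1 t) //= big1 ?addr0 => [|t' neq_t].
  rewrite lin_mulmx_entry eqxx mxE; apply: eq_bigr => q' _.
  by rewrite [in LHS]mxE [in RHS]mxE !unmxvecK.
by rewrite lin_mulmx_entry (negPf neq_t) rmorph0 mul0mx mxE.
Qed.

Lemma evalmx_lin_mulmxr l d e (h : 'M[K]_(d, e)) (k : 'M[K]_(l * m.+1, d)) :
  evalmx phi (lin_mulmxr (map_mx iota h)) (spread k) = spread (k *m h).
Proof.
have -> : lin_mulmxr (map_mx iota h) = map_mx iota (lin_mulmxr h) :> 'M_(l * d, _).
  by symmetry; apply: map_lin_mx => A; rewrite /= map_mxM.
rewrite evalmx_map //; apply/matrixP => q v; case/mxvec_indexP: v => p t.
rewrite [LHS]mxE [RHS]mxE unmxvecK /= [RHS]mxE sum_mxvec.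
rewrite (bigD1 p) //= [X in _ + X]big1 ?addr0 => [|p' neq_p].
  by apply: eq_bigr => t' _; rewrite lin_mulmxr_entry eqxx mxE unmxvecK.
by rewrite big1 // => t' _; rewrite lin_mulmxr_entry (negPf neq_p) mulr0.
Qed.

Lemma evalmx_sum a b (J : finType) (X : J -> 'M[R]_(a, b)) x :
  evalmx phi (\sum_i X i) x = \sum_i evalmx phi (X i) x.
Proof.
apply/matrixP => p c; rewrite summxE [LHS]mxE.
under [RHS]eq_bigr => i _ do rewrite mxE.
rewrite exchange_big; apply: eq_bigr => k _ /=.
by rewrite summxE rmorph_sum mulmx_suml summxE.
Qed.

Lemma evalmx_sandwich (I : finType) l d e (T : I -> 'M[R]_l)
    (h : I -> 'M[K]_(d, e)) (k : 'M[K]_(l * m.+1, d)) :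
  evalmx phi (sandwich T (fun i => map_mx iota (h i))) (spread k) =
  spread (\sum_i blowmx (T i) *m k *m h i).
Proof.
rewrite /sandwich evalmx_sum; apply/esym.
transitivity (\sum_i spread (blowmx (T i) *m k *m h i)).
  apply/matrixP => q v; rewrite mxE !summxE; apply: eq_bigr => i _.
  by rewrite [RHS]mxE.
apply: eq_bigr => i _; rewrite evalmxM evalmx_lin_mulmx.
by rewrite evalmx_lin_mulmxr.
Qed.

(** A left inverse up to the scalar a over the ring of indeterminates becomes
    a left inverse after an evaluation that makes a invertible. *)
Lemma blowmx_injective (I : finType) l d e (T : I -> 'M[R]_l)
    (h : I -> 'M[K]_(d, e)) (P : 'M[R]_(l * e, l * d)) (a : R) :
  sandwich T (fun i => map_mx iota (h i)) *m P = a%:M -> phi a \in unitmx ->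
  forall k : 'M[K]_(l * m.+1, d), \sum_i blowmx (T i) *m k *m h i = 0 -> k = 0.
Proof.
move=> TP phi_a k Tk; apply: (@spread_inj l d); apply: (can_inj (mulKmx phi_a)).
have -> : spread (0 : 'M[K]_(l * m.+1, d)) = 0 by apply/matrixP => u v; rewrite !mxE.
rewrite mulmx0 -(evalmx_scalar phi_iota) -TP evalmxM evalmx_sandwich Tk.
have -> : spread (0 : 'M[K]_(l * m.+1, e)) = 0 by apply/matrixP => u v; rewrite !mxE.
by rewrite linear0.
Qed.

End Blowup.

(** * Injective blow-ups over the base field *)

Section GenericPoint.
Variables (K : fieldType) (n : nat).
Local Notation R := {mpoly K[n]}.
Variables (Q : fieldType) (j : {rmorphism R -> Q}).
Hypothesis j_inj : injective j.
Hypothesis j_frac : forall x : Q, exists n d : R, d != 0 /\ j d * x = j n.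
Local Notation iota := (@mpolyC n K).

(** Expansion over K passes to the field of rational functions: a subspace
    violating it has, together with its certificate of violation, finitely
    many denominators, and survives an evaluation at matrices that keeps them
    invertible. *)
Lemma expanding_generic (I : finType) (d e : nat) (h : I -> 'M[K]_(d, e)) :
  expanding (fun i => rmul 1 (h i)) ->
  forall s (N : 'M[R]_(s, d)), (0 < s)%N -> row_free (map_mx j N) ->
  (s < \rank (\sum_i <<map_mx j (N *m map_mx iota (h i))>>)%MS)%N.
Proof.
move=> exp_h s N s_gt0 /(frac_row_freeP j_inj j_frac) [a [P [a0 NP]]].
set W := (\sum_i _)%MS.
have /choice [C CE] : forall i, exists C : 'M[Q]_(s, \rank W),
    map_mx j (N *m map_mx iota (h i)) = C *m row_base W.
  move=> i; apply/submxP; rewrite eq_row_base; apply: (sumsmx_sup i) => //.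
  by rewrite genmxE.
have [b [B [b0 BE]]] := clear_denominators j_frac (row_base W).
have [c [C' [c0 C'E]]] := common_denominator j_frac
  (fun x : I * 'I_s * 'I_(\rank W) => C x.1.1 x.1.2 x.2).
have abc0 : a * (b * c) != 0 by rewrite !mulf_neq0.
have [m [phi [psi [phi_iota _]]]] := mpoly_unit_eval abc0.
rewrite rmorphM unitmx_mul => /andP[phi_a phi_bc].
apply: (expanding_evalmx phi_iota (expanding_amplify exp_h) NP _ phi_a phi_bc s_gt0
  (C := fun i => \matrix_(p, q) C' (i, p, q)) (D := B)).
move=> i; apply: (map_mx_frac_inj j_inj).
rewrite map_mxZ [X in _ *: X]CE map_mxM BE.
have -> : map_mx j (\matrix_(p, q) C' (i, p, q)) = j c *: C i.
  by apply/matrixP=> p q; rewrite !mxE C'E.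
by rewrite -scalemxAl -scalemxAr scalerA rmorphM mulrC.
Qed.

End GenericPoint.

Lemma injective_row_free (Q : fieldType) (a b : nat) (X : 'M[Q]_(a, b)) :
  (forall v : 'rV_a, v *m X = 0 -> v = 0) -> row_free X.
Proof.
move=> inj_X; rewrite -kermx_eq0; apply/eqP/row_matrixP=> i; rewrite row0.
by apply: inj_X; rewrite -row_mul mulmx_ker row0.
Qed.

(** Entries of the T_i are indeterminates, with partial derivatives as
    derivations; both families are generically injective once l is large, the
    second one because transposing a generic matrix gives a generic matrix. A
    single evaluation at commuting matrices keeps both denominators
    invertible. *)
Theorem blowup_injective (K : fieldType) (I : finType) (d e d1 e1 : nat)
    (h : I -> 'M[K]_(d, e)) (h1 : I -> 'M[K]_(d1, e1)) :
  expanding (fun i => rmul 1 (h i)) -> expanding (fun i => rmul 1 (h1 i)) ->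
  exists L (T : I -> 'M[K]_L), [/\ (0 < L)%N,
    forall k : 'M[K]_(L, d), \sum_i T i *m k *m h i = 0 -> k = 0
  & forall k : 'M[K]_(L, d1), \sum_i (T i)^T *m k *m h1 i = 0 -> k = 0].
Proof.
move=> exp_h exp_h1; pose l := (d * d + d1 * d1).+1.
pose X : finType := (I * 'I_l * 'I_l)%type.
pose R := {mpoly K[#|X|]}; pose Q := {fraction R}.
pose j : {rmorphism R -> Q} := @tofrac R.
pose iota := @mpolyC #|X| K.
have j_inj : injective j by move=> x y /eqP; rewrite tofrac_eq => /eqP.
have j_frac : forall x : Q, exists n d : R, d != 0 /\ j d * x = j n.
  exact: fraction_div.
pose T i : 'M[R]_l := \matrix_(p, q) 'X_(enum_rank ((i, p, q) : X)).
pose D (c : {ffun I -> 'M[Q]_l}) (x : R) : Q :=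
  \sum_(v : X) c v.1.1 v.1.2 v.2 * j (mderiv (enum_rank v) x).
have D_lin : forall x a c c', D (a *: c + c') x = a * D c x + D c' x.
  move=> x a c c'; rewrite /D mulr_sumr -big_split; apply: eq_bigr => v _ /=.
  by rewrite !ffunE !mxE mulrDl mulrA.
have DD : forall c x y, D c (x + y) = D c x + D c y.
  move=> c x y; rewrite /D -big_split; apply: eq_bigr => v _ /=.
  by rewrite mderivD rmorphD mulrDr.
have DM : forall c x y, D c (x * y) = D c x * j y + j x * D c y.
  move=> c x y; rewrite /D mulr_suml mulr_sumr -big_split.
  apply: eq_bigr => v _ /=; rewrite mderivM rmorphD !rmorphM mulrDr mulrA.
  by rewrite mulrCA.
have DX c (v : X) : D c 'X_(enum_rank v) = c v.1.1 v.1.2 v.2.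
  rewrite /D (bigD1 v) //= big1 ?addr0 => [|v' neq_v].
    rewrite mderivX mnm1E eqxx -[X in (X - _)%MM]add0m addmK.
    by rewrite scale1r mpolyX0 rmorph1 mulr1.
  rewrite mderivX mnm1E (inj_eq enum_rank_inj) eq_sym (negPf neq_v).
  by rewrite scale0r rmorph0 mulr0.
have D_T : forall c i p q, D c (T i p q) = c i p q by move=> c i p q; rewrite mxE DX.
have D_C c x : D c (iota x) = 0.
  by rewrite /D big1 // => v _; rewrite mderivC rmorph0 mulr0.
have free : row_free (map_mx j (sandwich T (fun i => map_mx iota (h i)))).
  apply: injective_row_free => v; rewrite map_sandwich -(vec_mxK v) sandwichE.
  move=> /(congr1 vec_mx); rewrite mxvecK linear0 => Tv0.
  suff -> : vec_mx v = 0 by rewrite linear0.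
  apply: (generic_injective j_inj j_frac D_lin DD DM D_T _ _ _ Tv0).
  - by move=> c i p q; rewrite mxE D_C.
  - exact: expanding_generic.
  - by rewrite /l; lia.
pose tr (c : {ffun I -> 'M[Q]_l}) : {ffun I -> 'M[Q]_l} := [ffun i => (c i)^T].
have free1 : row_free
    (map_mx j (sandwich (fun i => (T i)^T) (fun i => map_mx iota (h1 i)))).
  apply: injective_row_free => v; rewrite map_sandwich -(vec_mxK v) sandwichE.
  move=> /(congr1 vec_mx); rewrite mxvecK linear0 => Tv0.
  suff -> : vec_mx v = 0 by rewrite linear0.
  apply: (generic_injective j_inj j_frac (D := fun c => D (tr c)) _ _ _ _ _ _ _ Tv0).
  - move=> x a c c'; rewrite -D_lin; congr (D _ _); apply/ffunP => i.
    by rewrite !ffunE linearP.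
  - by move=> c; apply: DD.
  - by move=> c; apply: DM.
  - by move=> c i p q; rewrite mxE D_T ffunE mxE.
  - by move=> c i p q; rewrite mxE D_C.
  - exact: expanding_generic.
  - by rewrite /l; lia.
have [a [P [a0 TP]]] := frac_row_freeP j_inj j_frac free.
have [b [P1 [b0 TP1]]] := frac_row_freeP j_inj j_frac free1.
have ab0 : a * b != 0 by rewrite mulf_neq0.
have [m [phi [psi [phi_iota psiE]]]] := mpoly_unit_eval ab0.
rewrite rmorphM unitmx_mul => /andP[phi_a phi_b].
exists (l * m.+1)%N, (fun i => blowmx phi (T i)); split.
- by rewrite muln_gt0.
- exact: (blowmx_injective phi_iota TP phi_a).
have psi_iota c : psi (iota c) = c%:M by rewrite psiE phi_iota tr_scalar_mx.
have psi_b : psi b \in unitmx by rewrite psiE unitmx_tr.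
move=> k; have := blowmx_injective psi_iota TP1 psi_b (k := k).
suff -> : \sum_i blowmx psi (T i)^T *m k *m h1 i =
    \sum_i (blowmx phi (T i))^T *m k *m h1 i by [].
apply: eq_bigr => i _; congr (_ *m _ *m _).
by apply/matrixP => u v; rewrite !mxE psiE mxE.
Qed.

(** * Coordinate-free blow-ups *)

Lemma dim_limg_inj (K : fieldType) (V W : vectType K) (f : 'Hom(V, W))
    (U : {vspace V}) : injective f -> \dim (f @: U) = \dim U.
Proof. by move=> /lker0P/eqP kf; rewrite limg_dim_eq // kf capv0. Qed.

Lemma orthogonal_space (K : fieldType) (n : nat) (S : {vspace 'rV[K]_n}) :
  exists P : {vspace 'rV[K]_n}, (\dim P + \dim S = n)%N /\
    forall z, z \in P <-> forall s, s \in S -> z *m s^T = 0.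
Proof.
pose B : 'M[K]_(\dim S, n) := \matrix_i (vbasis S)`_i.
have BE (u : 'rV_(\dim S)) : u *m B = \sum_i u 0 i *: (vbasis S)`_i.
  by rewrite mulmx_sum_row; apply: eq_bigr => i _; rewrite rowK.
have B_free : row_free B.
  apply: injective_row_free => u; rewrite BE => u0; apply/rowP => i.
  have /freeP freeS := basis_free (vbasisP S).
  by rewrite mxE; apply: (freeS (fun i => u 0 i)).
have [C BC] := row_freeP B_free.
exists (lker (rmul 1 B^T)); split.
  have : limg (rmul 1 B^T) = fullv.
    apply/eqP; rewrite eqEsubv subvf /=.
    apply/subvP => w _; apply/memv_imgP; exists (w *m C^T); first exact: memvf.
    by rewrite rmulE -mulmxA -trmx_mul BC trmx1 mulmx1.
  have := limg_ker_dim (rmul 1 B^T) fullv; rewrite capfv => + imB.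
  by rewrite imB !dimvM !mul1n.
move=> z; rewrite memv_ker rmulE.
have zB (i : 'I_(\dim S)) : z *m ((vbasis S)`_i)^T = ((z *m B^T) 0 i)%:M.
  apply/matrixP => u v; rewrite !ord1 !mxE eqxx; apply: eq_bigr => t _.
  by rewrite !mxE.
split=> [/eqP zB0 s /coord_vbasis ->|zS].
  rewrite linear_sum mulmx_sumr big1 // => i _.
  by rewrite linearZ -scalemxAr zB zB0 mxE -scalemx1 scale0r scaler0.
apply/eqP/rowP => i.
have bS : (vbasis S)`_i \in S by apply/vbasis_mem/mem_nth; rewrite size_tuple.
by have /matrixP/(_ 0 0) := zS _ bS; rewrite zB mxE eqxx mulr1n => ->; rewrite !mxE.
Qed.

(** Transposition turns the blow-up of a family into the blow-up of the dual
    family with transposed coefficients, so surjectivity for one is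
    injectivity for the other. *)
Lemma sandwich_tr (K : fieldType) (I : finType) (l d e : nat)
    (T : I -> 'M[K]_l) (h : I -> 'M[K]_(d, e)) :
  sandwich (fun i => (T i)^T) (fun i => (h i)^T) = (sandwich T h)^T.
Proof.
have entry f g (S : I -> 'M[K]_l) (k : I -> 'M[K]_(f, g)) p t p' t' :
    sandwich S k (mxvec_index p t) (mxvec_index p' t') =
    \sum_i S i p' p * k i t t'.
  rewrite /sandwich summxE; apply: eq_bigr => i _; rewrite mxE sum_mxvec.
  rewrite (bigD1 p') //= [X in _ + X]big1 ?addr0 => [|q neq_q].
    rewrite (bigD1 t) //= big1 ?addr0 => [|s neq_s].
      by rewrite lin_mulmx_entry lin_mulmxr_entry !eqxx.
    by rewrite lin_mulmx_entry eq_sym (negPf neq_s) mul0r.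
  by rewrite big1 // => s _; rewrite lin_mulmxr_entry (negPf neq_q) mulr0.
apply/matrixP => u v; case/mxvec_indexP: u => p t; case/mxvec_indexP: v => p' t'.
by rewrite [RHS]mxE !entry; apply: eq_bigr => i _; rewrite !mxE.
Qed.

(** The hypothesis on the second family is the expansion of its dual family,
    read on annihilators. *)
Theorem blowup_injective_surjective (K : fieldType) (I : finType)
    (V W V2 W2 : vectType K)
    (D : {vspace V}) (h : I -> 'Hom(V, W)) (h2 : I -> 'Hom(V2, W2)) :
  (forall S : {vspace V}, (S <= D)%VS -> S != 0%VS ->
     (\dim S < \dim (\sum_i h i @: S)%VS)%N) ->
  (forall S : {vspace W2}, S != fullv ->
     (\dim {:W2} + \dim (\bigcap_i (h2 i @^-1: S))%VS < \dim {:V2} + \dim S)%N) ->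
  exists L (T : I -> 'M[K]_L), [/\ (0 < L)%N,
    forall y : 'I_L -> V, (forall p, y p \in D) ->
      (forall q, \sum_p \sum_i T i q p *: h i (y p) = 0) -> forall p, y p = 0
  & forall z : 'I_L -> W2, exists y : 'I_L -> V2,
      forall q, z q = \sum_p \sum_i T i q p *: h2 i (y p)].
Proof.
move=> exp_h exp_h2.
have arith (a b p s p' hs : nat) :
    (p + s = a -> p' + hs = b -> a + p' < b + p -> s < hs)%N by lia.
pose J : 'Hom('rV[K]_(dim (subvs_of D)), V) := linfun (vsval \o r2v).
pose E : 'Hom(W, 'rV[K]_(dim W)) := linfun v2r.
pose H i := lin1_mx (E \o h i \o J)%VF.
have EE x : E x = v2r x by rewrite lfunE.
have HE i u : u *m H i = v2r (h i (J u)) by rewrite mul_rV_lin1 /= !comp_lfunE EE.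
have JE u : J u = vsval (r2v u) by rewrite lfunE.
have J_inj : injective J.
  by move=> u v; rewrite !JE => /subvs_inj /(can_inj r2vK).
have E_inj : injective E by move=> u v; rewrite !lfunE => /(can_inj v2rK).
have exp_H : expanding (fun i => rmul 1 (H i)).
  move=> S S_neq0.
  have -> : (\sum_i rmul 1 (H i) @: S = E @: (\sum_i h i @: (J @: S)))%VS.
    rewrite limg_sum; apply: eq_bigr => i _; rewrite -!limg_comp.
    by apply: eq_in_limg => u _; rewrite rmulE HE !comp_lfunE EE.
  rewrite (dim_limg_inj _ E_inj) -(dim_limg_inj _ J_inj); apply: exp_h.
    by apply/subvP => _ /memv_imgP [u _ ->]; rewrite JE subvsP.
  by rewrite -dimv_eq0 (dim_limg_inj _ J_inj) dimv_eq0.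
pose E2 : 'Hom(W2, 'rV[K]_(dim W2)) := linfun v2r.
pose J2 : 'Hom('rV[K]_(dim V2), V2) := linfun r2v.
pose H2 i := lin1_mx (E2 \o h2 i \o J2)%VF.
have H2E i u : u *m H2 i = v2r (h2 i (r2v u)).
  by rewrite mul_rV_lin1 /= !comp_lfunE !lfunE.
have exp_H2 : expanding (fun i => rmul 1 (H2 i)^T).
  move=> S S_neq0; set HS := (\sum_i _)%VS.
  have [P [dimP memP]] := orthogonal_space S.
  have [P' [dimP' memP']] := orthogonal_space HS.
  pose S' := (E2 @^-1: P)%VS.
  have dimS' : \dim S' = \dim P.
    have E2_inj : injective E2 by move=> u v; rewrite !lfunE => /(can_inj v2rK).
    rewrite -(dim_limg_inj S' E2_inj) lpreimK //; apply/subvP => u _.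
    by apply/memv_imgP; exists (r2v u); rewrite ?memvf // lfunE /= r2vK.
  have S'_proper : S' != fullv.
    apply/eqP => S'full; move: S_neq0; rewrite -dimv_eq0 -lt0n.
    have dP : \dim P = dim W2 by rewrite -dimS' S'full dimvf.
    by move: dimP; rewrite dP -[RHS]addn0 => /addnI ->.
  have := exp_h2 _ S'_proper; rewrite !dimvf dimS'.
  suff -> : \dim (\bigcap_i (h2 i @^-1: S')) = \dim P'.
    exact: arith dimP dimP'.
  rewrite -[RHS](dim_limg_inj _ (f := J2)); last first.
    by move=> u v; rewrite !lfunE => /(can_inj r2vK).
  congr (\dim _); apply/vspaceP => x; apply/idP/memv_imgP => [xS|[u uP' ->]].
    exists (v2r x); last by rewrite lfunE /= v2rK.
    apply/memP' => _ /memv_sumP [w wS ->]; rewrite linear_sum mulmx_sumr.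
    rewrite big1 // => i _; have /memv_imgP [s sS ->] := wS i isT.
    move: xS; rewrite memvE => /subv_bigcapP /(_ i isT); rewrite -memvE.
    rewrite -!memv_preim lfunE /= => /memP /(_ s sS).
    by rewrite rmulE trmx_mul trmxK mulmxA H2E v2rK.
  rewrite memvE; apply/subv_bigcapP => i _; rewrite -memvE -!memv_preim.
  rewrite lfunE /=; apply/memP => s sS; rewrite lfunE /= -H2E -mulmxA.
  rewrite -[H2 i]trmxK -trmx_mul; move/memP': uP'; apply.
  apply: (subvP (sumv_sup i _ (subvv _))) => //.
  by rewrite -rmulE memv_img.
have [L [T [L_gt0 inj_T inj_T']]] := blowup_injective exp_H exp_H2.
exists L, T; split=> // [y yD Ty0 p|z].
  pose k : 'M_(L, _) := \matrix_p v2r (vsproj D (y p)).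
  have yE q : y q = J (row q k) by rewrite JE rowK v2rK vsprojK.
  have k0 : k = 0.
    apply: inj_T; apply/row_matrixP => q; rewrite row0.
    have := congr1 v2r (Ty0 q); rewrite linear0 => <-.
    rewrite exchange_big !linear_sum /=; apply: eq_bigr => i _.
    rewrite !row_mul [X in X *m _]mulmx_sum_row mulmx_suml ?linear_sum.
    apply: eq_bigr => p' _.
    by rewrite mxE -scalemxAl HE -yE linearZ.
  by rewrite yE k0 row0 linear0.
have : row_full (sandwich T H2).
  rewrite /row_full -mxrank_tr -/(row_free _) -sandwich_tr.
  apply: injective_row_free => v.
  rewrite -(vec_mxK v) sandwichE => /(congr1 vec_mx).
  by rewrite mxvecK linear0 => /inj_T' ->; rewrite linear0.
case/row_fullP => C CT; pose Z : 'M_(L, _) := \matrix_q v2r (z q).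
pose k := vec_mx (mxvec Z *m C).
have kE : Z = \sum_i T i *m k *m H2 i.
  apply: (can_inj mxvecK); rewrite -sandwichE vec_mxK -mulmxA CT mulmx1 //.
exists (fun p => r2v (row p k)) => q; apply: (can_inj v2rK).
have -> : v2r (z q) = row q Z by rewrite rowK.
rewrite kE exchange_big !linear_sum /=; apply: eq_bigr => i _.
rewrite !row_mul [X in X *m _]mulmx_sum_row mulmx_suml ?linear_sum.
apply: eq_bigr => p' _.
by rewrite mxE -scalemxAl H2E linearZ.
Qed.

(** * Finitely generated modules as vector spaces *)

(** Discard redundant vectors; the coordinates on the remaining family are an
    isomorphism with a space of row vectors. *)
Lemma spanned_vector_axiom (K : fieldType) (V : lmodType K) (n : nat)
    (v : 'I_n -> V) :
  (forall x, exists c : 'I_n -> K, x = \sum_i c i *: v i) ->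
  exists d (iso : Vector.axiom d V), True.
Proof.
elim: n v => [|n IHn] v span_v.
  exists 0%N; unshelve eexists; last by []. exists (fun=> 0).
    by move=> a x y; rewrite scaler0 addr0.
  exists (fun=> 0) => x; last by rewrite thinmx0.
  by have [c ->] := span_v x; rewrite big_ord0.
have [[i [c vi]]|indep] := pselect (exists i c, v i = \sum_(k < n) c k *: v (lift i k)).
  apply: (IHn (fun k => v (lift i k))) => x; have [b ->] := span_v x.
  exists (fun k => b (lift i k) + b i * c k).
  rewrite (bigD1_ord i) //= vi scaler_sumr -big_split /=.
  by apply: eq_bigr => k _; rewrite scalerA scalerDl addrC.
pose g (u : 'rV[K]_n.+1) := \sum_i u 0 i *: v i.
have g_lin : linear g.
  move=> a x y; rewrite /g scaler_sumr -big_split; apply: eq_bigr => i _ /=.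
  by rewrite !mxE scalerA scalerDl.
have g_inj0 u : g u = 0 -> u = 0.
  move=> gu0; apply/rowP => i; rewrite mxE; apply/eqP; apply: contraPT gu0 => ui0 gu0.
  apply: indep; exists i, (fun k => - (u 0 i)^-1 * u 0 (lift i k)).
  have : (u 0 i)^-1 *: g u = 0 by rewrite gu0 scaler0.
  rewrite /g (bigD1_ord i) //= scalerDr scalerA mulVf // scale1r => /eqP.
  rewrite addr_eq0 => /eqP ->; rewrite -scalerN -sumrN scaler_sumr.
  by apply: eq_bigr => k _; rewrite scalerN scalerA mulNr scaleNr.
have g_inj : injective g.
  move=> x y eq_g; apply/eqP; rewrite -subr_eq0; apply/eqP/g_inj0.
  by rewrite -scaleN1r addrC g_lin eq_g scaleN1r addNr.
have /choice [f fE] : forall x, exists u : 'rV_n.+1, g u = x.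
  move=> x; have [c ->] := span_v x; exists (\row_i c i).
  by apply: eq_bigr => i _; rewrite mxE.
have f_lin : linear f by move=> a x y; apply: g_inj; rewrite g_lin !fE.
have f_bij : bijective f by exists g => // u; apply: g_inj; rewrite fE.
by exists n.+1, (exist2 _ _ f f_lin f_bij).
Qed.

Lemma linear_exists (R : pzRingType) (X Y : lmodType R) (f : X -> Y) :
  linear f -> exists F : {linear X -> Y}, F =1 f.
Proof.
move=> f_lin; pose fL := GRing.isLinear.Build R X Y _ f f_lin.
by exists (HB.pack f fL : {linear X -> Y}).
Qed.

Section ModuleSpace.
Variables (K : fieldType) (A : falgType K).
Implicit Types X Y Z : fgmodType A.

(** A finitely generated module, seen as a vector space over the base field;
    a separate type keeps the two scalar actions apart. *)
Definition kmod X : Type := X.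

HB.instance Definition _ X := GRing.Zmodule.on (kmod X).

Section Scale.
Variable X : fgmodType A.
Definition kscale (c : K) (x : kmod X) : kmod X := (c%:A : A) *: (x : X).

Fact kscaleA a b x : kscale a (kscale b x) = kscale (a * b) x.
Proof. by rewrite /kscale [LHS]scalerA -scalerAl mul1r scalerA. Qed.
Fact kscale1 : left_id 1 kscale.
Proof. by move=> x; rewrite /kscale scale1r [LHS]scale1r. Qed.
Fact kscaleDr : right_distributive kscale +%R.
Proof. by move=> c x y; apply: (@scalerDr A X). Qed.
Fact kscaleDl x : {morph kscale^~ x : a b / a + b}.
Proof. by move=> a b; rewrite /kscale scalerDl [LHS]scalerDl. Qed.
End Scale.

HB.instance Definition _ X := GRing.Zmodule_isLmodule.Build K (kmod X)
  (@kscaleA X) (@kscale1 X) (@kscaleDr X) (@kscaleDl X).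

Lemma kmod_finite_dim X : exists d (iso : Vector.axiom d (kmod X)), True.
Proof.
have [n [v span_v]] := fgmodP X; set b := vbasis {:A}.
pose w (k : 'I_#|{: 'I_n * 'I_(\dim {:A})}|) : kmod X :=
  let ij := enum_val k in (b`_ij.2 : A) *: v ij.1.
apply: (spanned_vector_axiom (v := w)) => x; have [a ->] := span_v x.
exists (fun k => let ij := enum_val k in coord b ij.2 (a ij.1)).
rewrite (reindex_onto enum_rank enum_val) /= => [|k _]; last exact: enum_valK.
under [RHS]eq_bigl => ij do rewrite enum_rankK eqxx.
rewrite /w; under [RHS]eq_bigr => ij _ do rewrite enum_rankK.
rewrite -(pair_bigA _ (fun i j => (coord b j (a i)) *: (((b`_j : A) *: v i) : kmod X))).
apply: eq_bigr => i _ /=.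
rewrite {1}(coord_vbasis (memvf (a i))) scaler_suml; apply: eq_bigr => k _.
by rewrite [RHS]scalerA -scalerAl mul1r.
Qed.


HB.instance Definition _ X := Lmodule_hasFinDim.Build K (kmod X)
  (projT1 (cid (projT2 (cid (kmod_finite_dim X))))).

Definition act X (a : A) (x : kmod X) : kmod X := a *: (x : X).

Fact act_linear X a : linear (@act X a).
Proof.
move=> c x y; rewrite /act [LHS]scalerDr; congr (_ + _).
by rewrite [LHS]scalerA [RHS]scalerA -scalerAl -scalerAr mul1r mulr1.
Qed.
HB.instance Definition _ X a :=
  GRing.isLinear.Build K (kmod X) (kmod X) _ (@act X a) (@act_linear X a).

Definition lact X (a : A) : 'End(kmod X) := linfun (@act X a).

Lemma lactE X a x : lact X a x = act a x. Proof. by rewrite lfunE. Qed.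

Definition stable X (U : {vspace kmod X}) := forall a x, x \in U -> act a x \in U.

Definition kfun X Y (f : {linear X -> Y}) : kmod X -> kmod Y := f.
Fact kfun_linear X Y (f : {linear X -> Y}) : linear (kfun f).
Proof. by move=> c x y; rewrite /kfun linearP. Qed.
HB.instance Definition _ X Y f :=
  GRing.isLinear.Build K (kmod X) (kmod Y) _ (@kfun X Y f) (@kfun_linear X Y f).

Definition klin X Y (f : {linear X -> Y}) : 'Hom(kmod X, kmod Y) := linfun (kfun f).

Lemma klinE X Y (f : {linear X -> Y}) (x : X) : klin f x = f x.
Proof. by rewrite lfunE. Qed.

End ModuleSpace.

Section Actions.
Variables (K : fieldType) (A : falgType K).

(** A module structure on a given vector space; bundled, so that submodules
    and quotients can be realised on subspaces without a second scalar action
    on the same type. *)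
Record module_action (V : vectType K) := ModuleAction {
  action_fun : A -> V -> V;
  actionA : forall a b v, action_fun a (action_fun b v) = action_fun (a * b) v;
  action1 : left_id 1 action_fun;
  actionDr : right_distributive action_fun +%R;
  actionDl : forall v, {morph action_fun^~ v : a b / a + b};
  actionZ : forall c v, action_fun c%:A v = c *: v }.

Definition acted V (s : module_action V) : Type := V.
HB.instance Definition _ V (s : module_action V) := GRing.Zmodule.on (acted s).
HB.instance Definition _ V (s : module_action V) :=
  GRing.Zmodule_isLmodule.Build A (acted s) (@actionA V s) (@action1 V s)
    (@actionDr V s) (@actionDl V s).

Lemma acted_fg V (s : module_action V) : finitely_generated (acted s).
Proof.
exists (\dim {:V}), (fun i => (vbasis {:V})`_i : V) => x.
exists (fun i => (coord (vbasis {:V}) i x)%:A).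
rewrite {1}(coord_vbasis (memvf (x : V))); apply: eq_bigr => i _.
by rewrite -(actionZ s).
Qed.

Definition acted_fgmod V (s : module_action V) : fgmodType A := FgMod (acted_fg s).

Lemma act1 (X : fgmodType A) (x : kmod X) : act (1 : A) x = x.
Proof. by rewrite /act [LHS]scale1r. Qed.
Lemma actM (X : fgmodType A) (a b : A) (x : kmod X) : act (a * b) x = act a (act b x).
Proof. by rewrite /act [RHS]scalerA. Qed.
Lemma actD (X : fgmodType A) (a b : A) (x : kmod X) : act (a + b) x = act a x + act b x.
Proof. by rewrite /act [LHS]scalerDl. Qed.
Lemma actZ (X : fgmodType A) (c : K) (a : A) (x : kmod X) :
  act (c *: a) x = c *: act a x.
Proof. by rewrite -[c *: a]mulr_algl actM. Qed.

Lemma actB (X : fgmodType A) (a b : A) (x : kmod X) : act (a - b) x = act a x - act b x.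
Proof. by rewrite actD -scaleN1r actZ scaleN1r. Qed.

Lemma submodule_exists (X : fgmodType A) (U : {vspace kmod X}) :
  stable U -> exists (Y : fgmodType A) (i : {linear Y -> X}),
    injective i /\ forall x : kmod X, x \in U <-> exists y, i y = x.
Proof.
move=> stU; pose f (a : A) (u : subvs_of U) : subvs_of U := vsproj U (act a (vsval u)).
have fE a u : vsval (f a u) = act a (vsval u) by rewrite vsprojK // stU ?subvsP.
have fA a b v : f a (f b v) = f (a * b) v by apply: subvs_inj; rewrite !fE actM.
have f1 : left_id 1 f by move=> v; apply: subvs_inj; rewrite fE act1.
have fDr : right_distributive f +%R.
  by move=> a u v; apply: subvs_inj; rewrite fE !linearD /= !fE.
have fDl v : {morph f^~ v : a b / a + b}.
  by move=> a b; apply: subvs_inj; rewrite linearD /= !fE actD.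
have fZ c v : f c%:A v = c *: v.
  by apply: subvs_inj; rewrite fE linearZ /= actZ act1.
pose s := ModuleAction fA f1 fDr fDl fZ.
have i_lin : linear (vsval : acted_fgmod s -> X).
  move=> a u v; rewrite [LHS](linearD (vsval : subvs_of U -> _)).
  by apply: (congr1 (fun w : X => w + vsval v) (fE a u)).
have [i iE] := linear_exists i_lin; exists (acted_fgmod s), i; split.
  move=> u v; rewrite !iE => eq_uv; apply: subvs_inj.
  exact: (eq_uv : vsval (u : subvs_of U) = vsval (v : subvs_of U)).
move=> x; split=> [xU|[y <-]]; last by rewrite iE subvsP.
by exists (vsproj U x); rewrite iE vsprojK.
Qed.

(** The quotient is realised on a vector-space complement of U, with the
    action followed by the projection along U. *)
Lemma quotient_exists (X : fgmodType A) (U : {vspace kmod X}) :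
  stable U -> exists (Y : fgmodType A) (p : {linear X -> Y}),
    surjective p /\ forall x : kmod X, x \in U <-> p x = 0.
Proof.
move=> stU.
pose p : 'Hom(kmod X, subvs_of U^C) :=
  (linfun (vsproj U^C) \o daddv_pi U^C U)%VF.
have capUC : (U :&: U^C = 0)%VS by rewrite capv_compl.
have capCU : (U^C :&: U = 0)%VS by rewrite capvC.
have pE x : vsval (p x) = daddv_pi U^C U x.
  by rewrite comp_lfunE lfunE vsprojK // memv_pi.
have decomp x : x = daddv_pi U U^C x + vsval (p x).
  by rewrite pE daddv_pi_add // addv_complf memvf.
have pK v : p (vsval v) = v by apply: subvs_inj; rewrite pE daddv_pi_id ?subvsP.
have p0 x : x \in U <-> p x = 0.
  split=> [xU|px0]; last first.
    by rewrite (decomp x) px0 linear0 addr0 memv_pi.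
  apply: subvs_inj; rewrite linear0; apply: (addrI x).
  by rewrite addr0 {3}(decomp x) daddv_pi_id.
have pmod a x : p (act a (vsval (p x))) = p (act a x).
  rewrite {2}(decomp x) !linearD /=.
  by have /p0 -> := stU a _ (memv_pi U U^C x); rewrite add0r.
pose f (a : A) (u : subvs_of U^C) : subvs_of U^C := p (act a (vsval u)).
have fA a b v : f a (f b v) = f (a * b) v by rewrite /f pmod actM.
have f1 : left_id 1 f by move=> v; rewrite /f act1 pK.
have fDr : right_distributive f +%R by move=> a u v; rewrite /f !linearD.
have fDl v : {morph f^~ v : a b / a + b} by move=> a b; rewrite /f actD linearD.
have fZ c v : f c%:A v = c *: v by rewrite /f actZ act1 linearZ /= pK.
pose s := ModuleAction fA f1 fDr fDl fZ.
have p_lin : linear (p : X -> acted_fgmod s).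
  move=> a u v; rewrite [LHS](linearD p); congr (_ + _).
  by rewrite -[RHS]/(f a (p u)) /f pmod.
have [q qE] := linear_exists p_lin; exists (acted_fgmod s), q; split.
  by move=> y; exists (vsval (y : subvs_of U^C)); rewrite qE pK.
by move=> x; rewrite qE; apply: p0.
Qed.
End Actions.

(** * Ranks at idempotents *)

Section Factor.
Variables (R : pzRingType) (X Y Z : lmodType R).

Lemma factor_surjective (p : {linear X -> Y}) (g : {linear X -> Z}) :
  surjective p -> (forall x, p x = 0 -> g x = 0) ->
  exists h : {linear Y -> Z}, forall x, h (p x) = g x.
Proof.
move=> /choice [s sK] ker_pg.
have gs y x : p x = y -> g (s y) = g x.
  move=> px; apply/eqP; rewrite -subr_eq0 -linearB; apply/eqP/ker_pg.
  by rewrite linearB /= sK px subrr.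
have h_lin : linear (g \o s).
  move=> a y y' /=; rewrite -linearP; apply: gs.
  by rewrite linearP !sK.
have [h hE] := linear_exists h_lin; exists h => x.
by rewrite hE; apply: gs.
Qed.

Lemma factor_injective (i : {linear Y -> X}) (f : {linear Z -> X}) :
  injective i -> (forall z, exists y, i y = f z) ->
  exists h : {linear Z -> Y}, forall z, i (h z) = f z.
Proof.
move=> i_inj /choice [h hE].
have h_lin : linear h by move=> a z z'; apply: i_inj; rewrite linearP !hE linearP.
by have [h' h'E] := linear_exists h_lin; exists h' => z; rewrite h'E.
Qed.
End Factor.

Section Ranks.
Variables (K : fieldType) (A : falgType K).
Implicit Types X Y Z : fgmodType A.

Definition idempotent_elt (e : A) := e * e = e.

(** For idempotent [e], the dimension of Hom(A e, X). *)
Definition rank_at X (e : A) : nat := \dim (limg (lact X e)).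

Lemma klin_act X Y (f : {linear X -> Y}) a x : klin f (act a x) = act a (klin f x).
Proof. by rewrite !klinE /act linearZ. Qed.

Lemma limg_lact1 X : limg (lact X 1) = fullv.
Proof.
apply/vspaceP => x; rewrite memvf; apply/memv_imgP; exists x; first exact: memvf.
by rewrite lactE act1.
Qed.

Lemma rank_at1 X : rank_at X 1 = \dim {:kmod X}.
Proof. by rewrite /rank_at limg_lact1. Qed.

Lemma zero_moduleP X : zero_module X <-> \dim {:kmod X} = 0%N.
Proof.
split=> [X0|/eqP]; last first.
  rewrite dimv_eq0 => /eqP X0 x; apply/eqP; rewrite -(@memv0 _ (kmod X)).
  by rewrite -X0 memvf.
apply/eqP; rewrite dimv_eq0 -subv0; apply/subvP => x _.
by rewrite memv0; apply/eqP/X0.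
Qed.

Lemma mem_limg_idem X e (x : kmod X) :
  idempotent_elt e -> (x \in limg (lact X e)) = (act e x == x).
Proof.
move=> ee; apply/memv_imgP/eqP => [[y _ ->]|xe].
  by rewrite lactE -actM ee.
by exists x; rewrite ?memvf // lactE.
Qed.

Lemma mem_act_idem X e (U : {vspace kmod X}) x : idempotent_elt e -> stable U ->
  (x \in lact X e @: U)%VS = (x \in U) && (act e x == x).
Proof.
move=> ee stU; apply/memv_imgP/andP => [[y yU ->]|[xU /eqP xe]].
  by rewrite lactE -actM ee stU.
by exists x; rewrite ?lactE.
Qed.

Lemma klin_surj X Y (f : {linear X -> Y}) : surjective f -> limg (klin f) = fullv.
Proof.
move=> f_surj; apply/vspaceP => y; rewrite memvf; apply/memv_imgP.
by have [x <-] := f_surj y; exists x; rewrite ?memvf ?klinE.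
Qed.

Lemma klin_lact X Y (f : {linear X -> Y}) a :
  (klin f \o lact X a = lact Y a \o klin f)%VF.
Proof. by apply/lfunP => x; rewrite !comp_lfunE !lactE klin_act. Qed.

Lemma rank_at_inj X Y (f : {linear X -> Y}) a (U : {vspace kmod Y}) :
  injective f -> limg (klin f) = U -> rank_at X a = \dim (lact Y a @: U).
Proof.
move=> f_inj <-; rewrite -limg_comp -klin_lact limg_comp limg_dim_eq //.
have /lker0P/eqP -> : injective (klin f) by move=> x y; rewrite !klinE; apply: f_inj.
by rewrite capv0.
Qed.

Lemma dim_leq_inj X Y (f : {linear X -> Y}) :
  injective f -> (\dim {:kmod X} <= \dim {:kmod Y})%N.
Proof.
by move=> f_inj; rewrite -rank_at1 (rank_at_inj 1 f_inj erefl) dimvS ?subvf.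
Qed.

(** Taking e-fixed vectors is exact: if e y = y is killed by g and y = f x,
    then y = f (e x). *)
Lemma rank_at_exact X Y Z (f : {linear X -> Y}) (g : {linear Y -> Z}) e :
  short_exact f g -> idempotent_elt e ->
  rank_at Y e = (rank_at X e + rank_at Z e)%N.
Proof.
move=> [f_inj g_surj fg] ee; rewrite (rank_at_inj e f_inj erefl).
rewrite {1}/rank_at -(limg_ker_dim (klin g) (limg (lact Y e))).
congr (_ + _)%N; last first.
  by rewrite -limg_comp klin_lact limg_comp klin_surj.
congr (\dim _); apply/vspaceP => y; rewrite memv_cap mem_limg_idem // memv_ker klinE.
rewrite mem_act_idem //.
  rewrite andbC; congr (_ && _); apply/eqP/memv_imgP => [/fg [x fx]|[x _ ->]].
    by exists x; rewrite ?memvf // klinE.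
  by rewrite klinE; apply/fg; exists x.
move=> a _ /memv_imgP [x _ ->]; rewrite -klin_act; apply/memv_img/memvf.
Qed.

Lemma short_exactI X Y Z (f : {linear X -> Y}) (g : {linear Y -> Z})
    (U : {vspace kmod Y}) :
  injective f -> (forall y : kmod Y, y \in U <-> exists x, f x = y) ->
  surjective g -> (forall y : kmod Y, y \in U <-> g y = 0) -> short_exact f g.
Proof.
by move=> f_inj fU g_surj gU; split=> // y; rewrite -(fU y) -(gU y).
Qed.

Lemma stable_limg X Y (f : {linear X -> Y}) : stable (limg (klin f)).
Proof. by move=> a _ /memv_imgP [x _ ->]; rewrite -klin_act memv_img ?memvf. Qed.

Lemma stable_lker X Y (f : {linear X -> Y}) : stable (lker (klin f)).
Proof. by move=> a x; rewrite !memv_ker klin_act => /eqP ->; rewrite linear0. Qed.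

Lemma stable0 X : stable (0%VS : {vspace kmod X}).
Proof. by move=> a x; rewrite !memv0 => /eqP ->; rewrite linear0. Qed.

Lemma stablef X : stable (fullv : {vspace kmod X}).
Proof. by move=> a x _; apply: memvf. Qed.

Lemma stableD X (U V : {vspace kmod X}) : stable U -> stable V -> stable (U + V)%VS.
Proof.
move=> stU stV a _ /memv_addP [u uU [v vV ->]].
by rewrite linearD memv_add ?stU ?stV.
Qed.

Lemma stableI X (U V : {vspace kmod X}) : stable U -> stable V -> stable (U :&: V)%VS.
Proof.
by move=> stU stV a x; rewrite !memv_cap => /andP[xU xV]; rewrite stU ?stV.
Qed.

Lemma stable_exact X (U : {vspace kmod X}) : stable U ->
  exists (Y Z : fgmodType A) (i : {linear Y -> X}) (p : {linear X -> Z}),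
    [/\ short_exact i p, forall x : kmod X, x \in U <-> exists y, i y = x
      & forall x : kmod X, x \in U <-> p x = 0].
Proof.
move=> stU; have [Y [i [i_inj iU]]] := submodule_exists stU.
have [Z [p [p_surj pU]]] := quotient_exists stU.
by exists Y, Z, i, p; split=> //; apply: short_exactI pU.
Qed.

Lemma limg_klin X Y (f : {linear X -> Y}) (U : {vspace kmod Y}) :
  (forall y : kmod Y, y \in U <-> exists x, f x = y) -> limg (klin f) = U.
Proof.
move=> fU; apply/vspaceP => y; apply/memv_imgP/idP => [[x _ ->]|/fU [x <-]].
  by rewrite klinE; apply/fU; exists x.
by exists x; rewrite ?memvf ?klinE.
Qed.

Lemma product_fg X Z : finitely_generated (X * Z)%type.
Proof.
have [n [v span_v]] := fgmodP X; have [m [w span_w]] := fgmodP Z.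
exists (n + m)%N.
exists (fun k => match split k with inl i => (v i, 0) | inr i => (0, w i) end).
move=> [x z]; have [a ->] := span_v x; have [b ->] := span_w z.
exists (fun k => match split k with inl i => a i | inr i => b i end).
have eqL (i : 'I_n) : split (lshift m i) = inl i by exact: unsplitK (inl i).
have eqR (i : 'I_m) : split (rshift n i) = inr i by exact: unsplitK (inr i).
rewrite big_split_ord /=.
under [X in _ = X + _]eq_bigr => i _ do rewrite eqL.
under [X in _ = _ + X]eq_bigr => i _ do rewrite eqR.
apply: injective_projections => /=.
  rewrite !raddf_sum /= [X in _ + X]big1 ?addr0 => [|i _]; first by [].
  by rewrite /= scaler0.
rewrite !raddf_sum /= [X in X + _]big1 ?add0r => [|i _]; first by [].
by rewrite /= scaler0.
Qed.

Lemma direct_sum_exact X Z :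
  exists (Y : fgmodType A) (f : {linear X -> Y}) (g : {linear Y -> Z}), short_exact f g.
Proof.
have fg := product_fg X Z.
have f_lin : linear (fun x : X => (x, 0) : X * Z).
  by move=> a x y; apply: injective_projections; rewrite /= ?scaler0 ?addr0.
have g_lin : linear (fun y : X * Z => y.2) by [].
have [f fE] := @linear_exists _ X (FgMod fg) _ f_lin.
have [g gE] := @linear_exists _ (FgMod fg) Z _ g_lin.
exists (FgMod fg), f, g; split.
- by move=> x y; rewrite !fE => -[].
- by move=> z; exists (0, z); rewrite gE.
- move=> [x z]; rewrite gE /=; split=> [->|[x']]; first by exists x; rewrite fE.
  by rewrite fE => -[].
Qed.

End Ranks.

(** * Gordan's alternative, finiteness of ranks, torsion sequences *)

Lemma int_upper_bound m (f : 'I_m -> int) : exists2 N : int, 0 < N & forall i, f i < N.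
Proof.
exists (1 + \sum_i `|f i|); first by rewrite ltr_wpDr // sumr_ge0.
move=> i; rewrite (bigD1 i) //= addrCA.
apply: le_lt_trans (ler_norm (f i)) _; rewrite ltrDl ltr_wpDr //.
by apply: sumr_ge0.
Qed.

(** Elimination on the first coordinate. If phi0 is positive elsewhere but
    takes the value - a < 0 there, consider the functions i |-> phi0(i) phi(0)
    + a phi(i), which vanish for phi = phi0. If one of them is positive, phi
    corrected by a suitable multiple of phi0 is positive everywhere; a
    relation between them is a relation on Phi with nonnegative coefficients. *)
Lemma gordan_alternative m (Phi : ('I_m -> int) -> Prop) :
  Phi (fun=> 0) ->
  (forall (a b : int) phi psi, Phi phi -> Phi psi ->
     Phi (fun i => a * phi i + b * psi i)) ->
  (exists2 phi, Phi phi & forall i, 0 < phi i) \/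
  (exists c : 'I_m -> int, [/\ forall i, 0 <= c i, exists i, 0 < c i
     & forall phi, Phi phi -> \sum_i c i * phi i = 0]).
Proof.
elim: m Phi => [|m IHm] Phi Phi0 Phi_lin.
  by left; exists (fun=> 0) => // -[].
pose Phi1 (psi : 'I_m -> int) :=
  exists2 phi, Phi phi & psi = fun i => phi (lift ord0 i).
have [|a b phi psi [phi' Pp ->] [psi' Pq ->]||] := IHm Phi1.
- by exists (fun=> 0).
- by exists (fun i => a * phi' i + b * psi' i); first exact: Phi_lin.
- move=> [_ [phi0 P0 ->]] phi0_gt0.
  have [phi00|phi00] := ltrP 0 (phi0 ord0).
    by left; exists phi0 => // i; case: (unliftP ord0 i) => [k|] ->.
  have [all0|] := pselect (forall phi, Phi phi -> phi ord0 = 0).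
    right; exists (fun i => (i == ord0)%:R); split.
    - by move=> i; case: eqP.
    - by exists ord0; rewrite eqxx.
    move=> phi Pphi; rewrite (bigD1 ord0) //= big1 => [|i /negPf ->].
      by rewrite all0 // mulr0 addr0.
    by rewrite mul0r.
  move=> /existsNP [phi /not_implyP [Pphi /eqP phi_neq0]].
  move: phi00; rewrite le_eqVlt => /orP[/eqP phi00|phi00].
    pose s : int := Num.sg (phi ord0).
    have [N N_gt0 NP] := int_upper_bound (fun i => - (s * phi (lift ord0 i))).
    left; exists (fun i => N * phi0 i + s * phi i); first exact: Phi_lin.
    move=> i; case: (unliftP ord0 i) => [k|] ->.
      have := NP k; have := phi0_gt0 k; nia.
    by rewrite phi00 mulr0 add0r /s -normrEsg normr_gt0.
  set a : int := - phi0 ord0; have a_gt0 : 0 < a by rewrite oppr_gt0.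
  pose Phi2 (psi : 'I_m -> int) := exists2 phi, Phi phi &
    psi = fun i => phi0 (lift ord0 i) * phi ord0 + a * phi (lift ord0 i).
  have [|u v f g [f' Pf ->] [g' Pg ->]||] := IHm Phi2.
  + by exists (fun=> 0) => //; apply/funext => i; rewrite !mulr0 addr0.
  + exists (fun i => u * f' i + v * g' i); first exact: Phi_lin.
    by apply/funext => i; ring.
  + move=> [_ [f Pf ->]] f_gt0.
    have [N N_gt0 NP] := int_upper_bound (fun i => phi0 (lift ord0 i)).
    left; exists (fun i => (N * a) * f i + (N * f ord0 - 1) * phi0 i).
      exact: Phi_lin.
    move=> i; case: (unliftP ord0 i) => [k|] ->; last by move: a_gt0; rewrite /a; lia.
    have := NP k; have := f_gt0 k.
    set x := phi0 (lift ord0 k) * f ord0 + a * f (lift ord0 k) => x_gt0 N_phi.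
    have -> : N * a * f (lift ord0 k) + (N * f ord0 - 1) * phi0 (lift ord0 k) =
      N * x - phi0 (lift ord0 k) by rewrite /x; ring.
    nia.
  move=> [c [c_ge0 [i0 ci0] c_rel]]; right.
  exists (fun i => if unlift ord0 i is Some k then a * c k
                   else \sum_k c k * phi0 (lift ord0 k)); split.
  + move=> i; case: (unliftP ord0 i) => [k _|_]; first by rewrite mulr_ge0 // ltW.
    by apply: sumr_ge0 => k _; rewrite mulr_ge0 // ltW // phi0_gt0.
  + by exists (lift ord0 i0); rewrite liftK mulr_gt0.
  move=> f Pf; rewrite big_ord_recl unlift_none mulr_suml -big_split /=.
  rewrite -[RHS](c_rel _ (ex_intro2 _ _ f Pf erefl)); apply: eq_bigr => k _.
  by rewrite liftK; ring.
move=> [c [c_ge0 [i0 ci0] c_rel]]; right.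
exists (fun i => if unlift ord0 i is Some k then c k else 0); split.
- by move=> i; case: (unliftP ord0 i).
- by exists (lift ord0 i0); rewrite liftK.
move=> f Pf; rewrite big_ord_recl unlift_none mul0r add0r.
rewrite -[RHS](c_rel _ (ex_intro2 _ _ f Pf erefl)); apply: eq_bigr => k _.
by rewrite liftK.
Qed.

Lemma bounded_maximum (P : nat -> Prop) (b : nat) :
  (exists n, P n) -> (forall n, P n -> n <= b)%N ->
  exists2 n, P n & forall k, P k -> (k <= n)%N.
Proof.
move=> [n0 Pn0] le_b; have exP : exists n, `[< P n >] by exists n0; apply/asboolP.
have ubP n : `[< P n >] -> (n <= b)%N by move=> /asboolP/le_b.
case: (ex_maxnP exP ubP) => n /asboolP Pn max_n; exists n => // k Pk.
exact/max_n/asboolP.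
Qed.

Section FiniteRanks.
Variables (K : fieldType) (A : falgType K) (X : fgmodType A).
Implicit Types U V W Z : {vspace kmod X}.

Lemma maximal_stable W : W != 0%VS -> exists W', [/\ stable W', (W' <= W)%VS, W' != W
  & forall V, stable V -> (W' <= V <= W)%VS -> V = W' \/ V = W].
Proof.
move=> W_neq0; pose P n := exists U, [/\ stable U, (U <= W)%VS, U != W & \dim U = n].
have [||n [W' [stW' leW' neqW' dimW']] max_n] := @bounded_maximum P (\dim W).
- exists 0%N, 0%VS; split; [exact: stable0|exact: sub0v| |exact: dimv0].
  by rewrite eq_sym.
- by move=> n [U [_ /dimvS leU _ <-]].
exists W'; split=> // V stV /andP[leV leVW].
have [|neqV] := eqVneq V W; first by right.
left; apply/eqP; rewrite eq_sym eqEdim leV dimW' max_n //.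
by exists V.
Qed.

Lemma rank_modular e U V : idempotent_elt e -> stable U -> stable V ->
  (\dim (lact X e @: (U + V)) + \dim (lact X e @: (U :&: V)) =
   \dim (lact X e @: U) + \dim (lact X e @: V))%N.
Proof.
move=> ee stU stV; rewrite -[RHS]dimv_sum_cap limgD; congr (_ + \dim _)%N.
apply/vspaceP => x; rewrite memv_cap !mem_act_idem ?memv_cap //; last exact: stableI.
by case: (_ == _); rewrite ?andbT ?andbF.
Qed.

(** For a maximal proper stable W' in W, a stable Z not contained in W'
    satisfies Z + W' = W, so the ranks of Z are those of its intersection with
    W' plus a constant. *)
Lemma finite_ranks W : stable W -> exists (J : finType) (g : J -> A -> nat),
  forall Z, stable Z -> (Z <= W)%VS ->
  exists j, forall e, idempotent_elt e -> \dim (lact X e @: Z) = g j e.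
Proof.
elim: {W}(\dim W).+1 {-2}W (ltnSn (\dim W)) => // n IHn W ltWn stW.
have [->|W_neq0] := eqVneq W 0%VS.
  exists unit, (fun _ _ => 0%N) => Z _; rewrite subv0 => /eqP ->.
  by exists tt => e _; rewrite limg0 dimv0.
have [W' [stW' leW' neqW' maxW']] := maximal_stable W_neq0.
have ltW' : (\dim W' < n)%N.
  apply: leq_trans (_ : \dim W <= n)%N; last by rewrite -ltnS.
  rewrite ltn_neqAle dimvS // andbT.
  by apply: contraNneq neqW' => eq_dim; rewrite eqEdim leW' eq_dim /=.
have [J [g gP]] := IHn _ ltW' stW'.
exists (J + J)%type, (fun j e => match j with inl i => g i e
  | inr i => (g i e + \dim (lact X e @: W) - \dim (lact X e @: W'))%N end).
move=> Z stZ leZ; have [leZW'|nleZW'] := boolP (Z <= W')%VS.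
  by have [j gj] := gP Z stZ leZW'; exists (inl j).
have [j gj] := gP (Z :&: W')%VS (stableI stZ stW') (capvSr _ _).
exists (inr j) => e ee; rewrite -gj //.
have ZW' : (Z + W')%VS = W.
  have [||//] := maxW' (Z + W')%VS (stableD stZ stW').
    by rewrite addvSr subv_add leZ leW'.
  by move=> eqZW'; case/negP: nleZW'; rewrite -eqZW' addvSl.
by have := rank_modular ee stZ stW'; rewrite ZW'; lia.
Qed.

Lemma finite_representatives (P : {vspace kmod X} -> Prop) :
  exists s : seq {vspace kmod X}, (forall Z, Z \in s -> stable Z /\ P Z) /\
    forall Z, stable Z -> P Z -> exists2 Z', Z' \in s &
      forall e, idempotent_elt e -> \dim (lact X e @: Z) = \dim (lact X e @: Z').
Proof.
have [J [g gP]] := finite_ranks (@stablef _ _ X).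
pose ok j Z := [/\ stable Z, P Z &
  forall e, idempotent_elt e -> \dim (lact X e @: Z) = g j e].
have /choice [r rP] : forall j, exists o : option {vspace kmod X},
    if o is Some Z then ok j Z else ~ exists Z, ok j Z.
  move=> j; have [[Z okZ]|noZ] := pselect (exists Z, ok j Z); last by exists None.
  by exists (Some Z).
exists (pmap r (enum J)); split.
  move=> Z; rewrite mem_pmap => /mapP [j _ rj]; have := rP j; rewrite -rj.
  by case.
move=> Z stZ PZ; have [j gj] := gP Z stZ (subvf _).
have okZ : ok j Z by [].
have := rP j; case rj: (r j) => [Z'|]; last by case; exists Z.
move=> [_ _ gZ']; exists Z'; last by move=> e ee; rewrite gj // gZ'.
by rewrite mem_pmap; apply/mapP; exists j; rewrite ?mem_enum.
Qed.

End FiniteRanks.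

Section Torsion.
Variables (K : fieldType) (A : falgType K).
Implicit Types X Y Z : fgmodType A.

(** The torsion part is a submodule in T of maximal dimension: the image of a
    map from T into the quotient pulls back to a larger extension in T. *)
Lemma torsion_sequence (T : subcategory A) X : torsion_class T ->
  exists (Y Z : fgmodType A) (i : {linear Y -> X}) (p : {linear X -> Z}),
    [/\ short_exact i p, T Y & right_perp T Z].
Proof.
move=> [T0 _ Tq Te].
pose P n := exists Y (i : {linear Y -> X}), [/\ injective i, T Y & \dim {:kmod Y} = n].
have [||n [Y [i [i_inj TY dimY]]] max_n] := @bounded_maximum P (\dim {:kmod X}).
- have [Y [i [i_inj iU]]] := submodule_exists (@stable0 _ _ X).
  have Y0 : zero_module Y.
    move=> y; apply: i_inj; rewrite linear0; apply/eqP.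
    by have /iU := ex_intro (fun y' => i y' = i y) y erefl; rewrite memv0.
  by exists 0%N, Y, i; split=> //; [apply: T0|apply/zero_moduleP].
- by move=> n [Y [i [i_inj _ <-]]]; apply: dim_leq_inj i_inj.
have iP (x : kmod X) : x \in limg (klin i) <-> exists y, i y = x.
  split=> [/memv_imgP [y _ ->]|[y <-]]; first by exists y; rewrite klinE.
  by rewrite -[i y]klinE memv_img ?memvf.
have [Z [p [p_surj pU]]] := quotient_exists (stable_limg (f := i)).
have ip : short_exact i p by apply: short_exactI pU.
have [_ _ ipE] := ip.
exists Y, Z, i, p; split=> // W TW g w.
have [G [ig [ig_inj igU]]] := submodule_exists (stable_limg (f := g)).
have gG (w' : W) : exists y, ig y = g w'.
  by apply/igU; rewrite -[g w']klinE memv_img ?memvf.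
have [g' g'E] := factor_injective ig_inj gG.
have TG : T G.
  apply: (Tq W G g' _ TW) => y.
  have /memv_imgP [w' _ eqw] : (ig y : kmod Z) \in limg (klin g) by apply/igU; exists y.
  by exists w'; apply: ig_inj; rewrite g'E eqw klinE.
pose V := (klin p @^-1: limg (klin g))%VS.
have stV : stable V.
  move=> a x; rewrite -!memv_preim klin_act; exact: stable_limg.
have [V' [i' [i'_inj i'U]]] := submodule_exists stV.
have [h hE] : exists h : {linear V' -> G}, forall v, ig (h v) = p (i' v).
  have [ph phE] := @linear_exists _ V' Z (p \o i') (linearP _).
  have [|h hE] := factor_injective (f := ph) ig_inj.
    move=> v; apply/igU; rewrite phE /= -[p _]klinE memv_preim.
    by apply/i'U; exists v.
  by exists h => v; rewrite hE phE.
have [k kE] : exists k : {linear Y -> V'}, forall y, i' (k y) = i y.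
  apply: (factor_injective i'_inj) => y; apply/i'U; rewrite -memv_preim klinE.
  have -> : p (i y) = 0 by apply/ipE; exists y.
  exact: mem0v.
have kh : short_exact k h.
  split.
  - by move=> y y' eqk; apply: i_inj; rewrite -!kE eqk.
  - move=> y; have [x px] := p_surj (ig y).
    have /i'U [v i'v] : (x : kmod X) \in V.
      by rewrite -memv_preim klinE px; apply/igU; exists y.
    by exists v; apply: ig_inj; rewrite hE i'v.
  move=> v; split=> [hv|[y <-]].
    have /ipE [y iy] : p (i' v) = 0 by rewrite -hE hv linear0.
    by exists y; apply: i'_inj; rewrite kE.
  apply: ig_inj; rewrite hE kE linear0; apply/ipE.
  by exists y.
have TV' : T V' by apply: Te kh TY TG.
have := rank_at_exact kh (mul1r 1); rewrite !rank_at1 dimY => dimV'.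
have dimG : \dim {:kmod G} = 0%N.
  have : (\dim {:kmod V'} <= n)%N by apply: max_n; exists V', i'.
  by rewrite dimV' addnC -[X in (_ <= X)%N]add0n leq_add2r leqn0 => /eqP.
have /zero_moduleP G0 := dimG.
by rewrite -g'E (G0 (g' w)) linear0.
Qed.

End Torsion.

(** * Ranks at idempotents determine classes in K_0 *)

Section Idempotents.
Variables (K : fieldType) (A : falgType K).

Lemma annihilating_poly (a : A) : exists2 p : {poly K}, p != 0 & horner_alg a p = 0.
Proof.
have F_lin : linear (fun u : 'rV[K]_(\dim {:A}).+1 => horner_alg a (rVpoly u)).
  by move=> c u v; rewrite linearP /= linearP /= mulr_algl.
have [F FE] := linear_hom F_lin.
have : lker F != 0%VS by apply: lker_neq0; rewrite dimvM mul1n.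
rewrite -subv0 => /subvPn [u]; rewrite memv_ker memv0 FE => /eqP Fu u_neq0.
exists (rVpoly u) => //; apply: contraNneq u_neq0 => u0.
by rewrite -[u]rVpolyK u0 linear0.
Qed.

(** Fitting's argument inside K[a]: if X^m q annihilates a with q(0) <> 0,
    Bezout gives an idempotent u(a) a^(m+1). Since a acts as 1 on the class of
    x, evaluation at 1 shows that the idempotent does too, and it kills
    whatever a kills. *)
Lemma idempotent_lift (X Y : fgmodType A) (X' : {vspace kmod X}) (a : A) (x : kmod X) :
  stable X' -> x \notin X' -> act a x - x \in X' ->
  (forall y : kmod Y, act a y = 0) ->
  exists e, [/\ idempotent_elt e, act e x - x \in X' & forall y : kmod Y, act e y = 0].
Proof.
move=> stX' xX' ax aY; have [p p_neq0 pa] := annihilating_poly a.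
have modX' (r : {poly K}) : act (horner_alg a r) x - r.[1] *: x \in X'.
  have /factor_theorem [s rs] : root (r - r.[1]%:P) 1.
    by rewrite rootE !hornerE subrr.
  have rE : horner_alg a r - r.[1] *: 1 = horner_alg a s * (a - 1).
    rewrite -(horner_algC a) -rmorphB rs rmorphM rmorphB /=.
    by rewrite horner_algX horner_algC scale1r.
  have <- : act (r.[1] *: (1 : A)) x = r.[1] *: x by rewrite actZ act1.
  by rewrite -actB rE actM actB act1 stX'.
have [m [q q0 pE]] := multiplicity_XsubC p 0.
rewrite p_neq0 /= polyC0 subr0 in q0 pE.
have p1 : p.[1] = 0.
  apply/eqP; apply: contraNT xX' => p1_neq0.
  have := modX' p; rewrite pa -[0 : A](scale0r 1) actZ scale0r sub0r memvN.
  by move=> /(memvZ p.[1]^-1); rewrite scalerK.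
have q1 : q.[1] = 0 by move: p1; rewrite pE !hornerE expr1n mulr1.
have : coprimep ('X^(m.+1)) q.
  by rewrite coprimep_expl // coprimep_sym coprimepX.
case/Bezout_eq1_coprimepP => -[u v] /= uv1.
have u1 : (u * 'X^(m.+1)).[1] = 1.
  have := congr1 (horner^~ 1) uv1.
  by rewrite hornerD [(v * q).[1]]hornerM q1 mulr0 addr0 hornerC.
exists (horner_alg a (u * 'X^(m.+1))); split.
- have : horner_alg a ((u * 'X^(m.+1)) * (v * q)) = 0.
    have -> : (u * 'X^(m.+1)) * (v * q) = u * 'X * v * p.
      by rewrite pE exprS; ring.
    by rewrite rmorphM /= pa mulr0.
  have -> : v * q = 1 - u * 'X^(m.+1) by rewrite -uv1 addrC addKr.
  rewrite /idempotent_elt mulrBr mulr1 rmorphB rmorphM /= => /eqP.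
  by rewrite subr_eq0 => /eqP.
- by have := modX' (u * 'X^(m.+1)); rewrite u1 scale1r.
move=> y; rewrite exprSr mulrA rmorphM /= horner_algX actM aY.
by rewrite linear0.
Qed.

End Idempotents.

Section GrothendieckGroup.
Variables (K : fieldType) (A : falgType K).
Implicit Types X Y Z : fgmodType A.

Lemma K0_zero_module Z : zero_module Z -> K0_eq (K0_class Z) K0_zero.
Proof.
move=> Z0; have id_lin : linear (@id Z) by [].
have [f fE] := linear_exists id_lin.
have ff : short_exact f f.
  split=> [y z _|z|z]; first by rewrite (Z0 y) (Z0 z).
    by exists z; rewrite fE.
  by split=> _; [exists z; rewrite fE|rewrite (Z0 (f z))].
have K0z := K0_exact ff; set z := K0_class Z in K0z *.
have K0Nz := K0_addN z.
apply: K0_trans (K0_sym (K0_add0 z)) _.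
apply: K0_trans (K0_add_congr (K0_sym K0Nz) (K0_refl z)) _.
apply: K0_trans (K0_sym (K0_addA _ _ _)) _.
apply: K0_trans K0Nz.
by apply: K0_add_congr; [apply: K0_refl|apply: K0_sym].
Qed.

(** Adding the elements of s one at a time, y is the one whose annihilation
    forces P. *)
Lemma last_separating_element (P : A -> Prop) Y (s : seq (kmod Y)) :
  ~ (forall a, P a) -> (forall a, (forall y, y \in s -> act a y = 0) -> P a) ->
  exists (t : seq (kmod Y)) (y : kmod Y),
    ~ (forall a, (forall z, z \in t -> act a z = 0) -> P a) /\
    forall a, (forall z, z \in t -> act a z = 0) -> act a y = 0 -> P a.
Proof.
move=> notP; elim: s => [|y s IHs] Ps.
  by case: notP => a; apply: Ps.
have [Ps'|notPs] := pselect (forall a, (forall z, z \in s -> act a z = 0) -> P a).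
  exact: IHs.
exists s, y; split=> // a as0 ay0; apply: Ps => z; rewrite inE => /predU1P [->//|].
exact: as0.
Qed.

(** The annihilator of Y is that of finitely many elements of Y; with t and y
    taken from them so that the left ideal L annihilating t moves x outside X'
    but its part annihilating y does not, a y |-> a x is well defined from L y
    to S, and onto because L x + X' = X by maximality. *)
Lemma simple_subquotient X Y (X' : {vspace kmod X}) (S : fgmodType A)
    (p : {linear X -> S}) (x : kmod X) :
  stable X' -> surjective p -> (forall z : kmod X, z \in X' <-> p z = 0) ->
  (forall V : {vspace kmod X}, stable V -> (X' <= V)%VS -> V = X' \/ V = fullv) ->
  x \notin X' ->
  (forall a, (forall y : kmod Y, act a y = 0) -> act a x \in X') ->
  exists (Y1 Y2 Q : fgmodType A) (i : {linear Y1 -> Y}) (q : {linear Y -> Q})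
      (j : {linear Y2 -> Y1}) (f : {linear Y1 -> S}),
    short_exact i q /\ short_exact j f.
Proof.
move=> stX' p_surj pX' maxX' xX' annY.
have [||t [y [tP tyP]]] := @last_separating_element
    (fun a => act a x \in X') Y (vbasis (fullv : {vspace kmod Y})).
- by move=> /(_ 1); rewrite act1; apply/negP.
- move=> a a0; apply: annY => y; rewrite (coord_vbasis (memvf y)) linear_sum.
  rewrite big1 // => k _; rewrite linearZ /= a0 ?scaler0 //.
  by apply: mem_nth; rewrite size_tuple.
have orb_lin X0 (z : kmod X0) : linear (fun a : A => act a z).
  by move=> c a b; rewrite actD actZ.
have /choice [ev evE] : forall z : kmod Y, exists F : 'Hom(A, kmod Y),
    forall a, F a = act a z.
  by move=> z; have [F FE] := linear_hom (orb_lin Y z); exists F.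
have [evx evxE] := linear_hom (orb_lin X x).
pose L := foldr (fun z V => lker (ev z) :&: V)%VS fullv t.
have LP a : a \in L <-> forall z, z \in t -> act a z = 0.
  rewrite /L; elim: {tP tyP L} t => [|z t IHt] /=; first by split; rewrite ?memvf.
  rewrite memv_cap memv_ker evE; split=> [/andP[/eqP az /IHt at0] z'|at0].
    by rewrite inE => /predU1P [->//|/at0].
  rewrite at0 ?mem_head // eqxx; apply/IHt => z' z't; apply: at0.
  by rewrite inE z't orbT.
have stL (X0 : fgmodType A) (F : 'Hom(A, kmod X0)) z :
    (forall a, F a = act a z) -> stable (F @: L)%VS.
  move=> FE b _ /memv_imgP [a /LP aL ->]; apply/memv_imgP; exists (b * a).
    by apply/LP => z' z't; rewrite actM aL ?linear0.
  by rewrite !FE actM.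
have [Y1 [Q [i [q [iq iU _]]]]] := stable_exact (stL Y (ev y) y (evE y)).
have /choice [g gP] : forall y1 : Y1, exists a, a \in L /\ act a y = i y1.
  move=> y1; have /memv_imgP [a aL eqa] : (i y1 : kmod Y) \in (ev y @: L)%VS.
    by apply/iU; exists y1.
  by exists a; rewrite -evE -eqa.
have wd a b : a \in L -> b \in L -> act a y = act b y ->
    p (act a x) = p (act b x).
  move=> aL bL eq_ab; apply/eqP; rewrite -subr_eq0 -linearB; apply/eqP/pX'.
  have := actB a b x; rewrite /act => <-.
  by apply: tyP; [apply/LP; rewrite rpredB|rewrite actB eq_ab subrr].
have f_lin : linear (fun y1 : Y1 => p (act (g y1) x)).
  move=> a y1 y2; have [g1L g1E] := gP y1; have [g2L g2E] := gP y2.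
  have [g3L g3E] := gP (a *: y1 + y2).
  have aL : a * g y1 + g y2 \in L.
    rewrite rpredD //; apply/LP => z zt; rewrite actM.
    by have /LP -> := g1L; rewrite ?linear0.
  rewrite (wd _ _ g3L aL); first by rewrite actD actM /act linearP.
  by rewrite g3E linearP actD actM g1E g2E.
have [f fE] := linear_exists f_lin.
have f_surj : surjective f.
  move=> s; have [z pz] := p_surj s.
  have [||eqX'|VX] := maxX' (evx @: L + X')%VS.
  - by apply: stableD => //; apply: (stL X evx x).
  - exact: addvSr.
  - case: tP => a /LP aL; rewrite -eqX'; apply: (subvP (addvSl _ _)).
    by rewrite -evxE memv_img.
  have : (z : kmod X) \in (evx @: L + X')%VS by rewrite VX memvf.
  case/memv_addP => _ /memv_imgP [a aL ->] [x' /pX' px' eqz].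
  have /iU [y1 iy1] : (act a y : kmod Y) \in (ev y @: L)%VS by rewrite -evE memv_img.
  exists y1; have [g1L g1E] := gP y1; rewrite fE (wd _ _ g1L aL) ?g1E ?iy1 //.
  by rewrite -pz eqz evxE [RHS]linearD px' addr0.
have [Y2 [j [j_inj jU]]] := submodule_exists (stable_lker (f := f)).
exists Y1, Y2, Q, i, q, j, f; split=> //; apply: (short_exactI j_inj jU f_surj).
by move=> y1; rewrite memv_ker klinE; split=> /eqP.
Qed.

Lemma rank_at_eq0 X e : rank_at X e = 0%N <-> forall x : kmod X, act e x = 0.
Proof.
split=> [/eqP|eX0]; last first.
  apply/eqP; rewrite dimv_eq0 -subv0; apply/subvP => _ /memv_imgP [x _ ->].
  by rewrite lactE eX0 mem0v.
rewrite dimv_eq0 => /eqP eX x; apply/eqP; rewrite -memv0 -eX -lactE.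
by rewrite memv_img ?memvf.
Qed.

(** If a in the annihilator of Y moved x outside X', some multiple of a would
    act as 1 on b = a x modulo X', and an idempotent in the annihilator of Y
    would then have nonzero rank on X. *)
Lemma annihilator_maximal X Y (X' : {vspace kmod X}) :
  stable X' ->
  (forall V : {vspace kmod X}, stable V -> (X' <= V)%VS -> V = X' \/ V = fullv) ->
  (forall e, idempotent_elt e -> rank_at Y e = 0%N -> rank_at X e = 0%N) ->
  forall (a : A) (x : kmod X), (forall y : kmod Y, act a y = 0) -> act a x \in X'.
Proof.
move=> stX' maxX' rkXY a x aY; apply: contraT => bX'; set b := act a x in bX' *.
have ev_lin : linear (fun c : A => act c b) by move=> c u v; rewrite actD actZ.
have [ev evE] := linear_hom ev_lin.
have [||eqX'|VX] := maxX' (limg ev + X')%VS.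
- apply: stableD => // c _ /memv_imgP [d _ ->].
  by rewrite evE -actM -evE memv_img ?memvf.
- exact: addvSr.
- case/negP: bX'; rewrite -eqX'; apply: (subvP (addvSl _ _)).
  by rewrite -[b]act1 -evE memv_img ?memvf.
have : x \in (limg ev + X')%VS by rewrite VX memvf.
case/memv_addP => _ /memv_imgP [c _ ->] [x' x'X' xE].
have [||e [ee eb eY]] := @idempotent_lift _ _ X Y X' (a * c) b stX' bX'.
- by rewrite actM -evE -[ev c](addrK x') -xE linearB /= addrAC subrr sub0r memvN stX'.
- by move=> y; rewrite actM aY.
case/negP: bX'; have /rank_at_eq0 eX0 : rank_at X e = 0%N.
  by apply: rkXY => //; apply/rank_at_eq0.
by move: eb; rewrite eX0 sub0r memvN.
Qed.

(** Induction on the dimension of X: a simple quotient S of X is a subquotient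
    of Y, and removing S from both leaves modules with equal ranks. *)
Theorem K0_eq_of_ranks X Y :
  (forall e, idempotent_elt e -> rank_at X e = rank_at Y e) ->
  K0_eq (K0_class X) (K0_class Y).
Proof.
have [n] := ubnP (\dim {:kmod X}); elim: n X Y => // n IHn X Y ltXn eqXY.
have [dimX0|dimX] := eqVneq (\dim {:kmod X}) 0%N.
  have Y0 : zero_module Y.
    by apply/zero_moduleP; rewrite -rank_at1 -eqXY ?rank_at1 // /idempotent_elt mulr1.
  apply: K0_trans (K0_zero_module _) (K0_sym (K0_zero_module Y0)).
  exact/zero_moduleP.
have X_neq0 : (fullv : {vspace kmod X}) != 0%VS by rewrite -dimv_eq0.
have [X' [stX' _ neqX' maxX'']] := maximal_stable X_neq0.
have maxX' (V : {vspace kmod X}) : stable V -> (X' <= V)%VS -> V = X' \/ V = fullv.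
  by move=> stV leV; apply: maxX''; rewrite ?leV ?subvf.
have [x _ xX'] : exists2 x : kmod X, x \in fullv & x \notin X'.
  by apply/subvPn; apply: contra neqX' => le; rewrite eqEsubv subvf le.
have [M [S [i [p [ip iX' pX']]]]] := stable_exact stX'.
have annX' a : (forall y : kmod Y, act a y = 0) -> act a x \in X'.
  by apply: annihilator_maximal => // e ee <-; apply: eqXY.
have [_ p_surj _] := ip.
have [Y1 [Y2 [Q [i1 [q [j [f [iq jf]]]]]]]] :=
  simple_subquotient stX' p_surj pX' maxX' xX' annX'.
have [Z [k [g kg]]] := direct_sum_exact Y2 Q.
have MZ : K0_eq (K0_class M) (K0_class Z).
  apply: IHn => [|e ee].
    have := rank_at_exact ip (mulr1 1); rewrite !rank_at1 => dimX_MS.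
    have dimS : (0 < \dim {:kmod S})%N.
      rewrite lt0n; apply/eqP => /zero_moduleP S0; case/negP: xX'.
      exact/pX'/S0.
    by move: ltXn; rewrite dimX_MS; lia.
  have := rank_at_exact ip ee; have := rank_at_exact iq ee.
  have := rank_at_exact jf ee; have := rank_at_exact kg ee; have := eqXY e ee; lia.
apply: K0_trans (K0_exact ip) _; apply: K0_trans _ (K0_sym (K0_exact iq)).
apply: K0_trans _ (K0_add_congr (K0_sym (K0_exact jf)) (K0_refl _)).
apply: K0_trans (K0_add_congr MZ (K0_refl _)) _.
apply: K0_trans (K0_add_congr (K0_exact kg) (K0_refl _)) _.
apply: K0_trans (K0_sym (K0_addA _ _ _)) _; apply: K0_trans _ (K0_addA _ _ _).
exact: K0_add_congr (K0_refl _) (K0_addC _ _).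
Qed.

End GrothendieckGroup.

(** * Separation by an integral weight *)

Section Separation.
Variables (K : fieldType) (A : falgType K).
Implicit Types X Y : fgmodType A.

(** The dimension as an invariant of K_0, used to see that a nonzero module
    has a nonzero class. *)
Fixpoint K0_dim (w : K0_word A) : int :=
  match w with
  | K0_class X => (\dim {:kmod X})%:Z
  | K0_zero => 0
  | K0_opp a => - K0_dim a
  | K0_add a b => K0_dim a + K0_dim b
  end.

Lemma K0_dim_eq a b : K0_eq a b -> K0_dim a = K0_dim b.
Proof.
elim=> //= {a b} [a b c _ -> _ -> //|a b _ -> //|a b c d _ -> _ -> //|a b c|a b|a|a|].
- by rewrite addrA.
- by rewrite addrC.
- by rewrite add0r.
- by rewrite addNr.
- move=> X Y Z f g fg; have := rank_at_exact fg (mulr1 1).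
  by rewrite !rank_at1 => ->; rewrite PoszD.
Qed.

Lemma zero_module_exists : exists Z : fgmodType A, zero_module Z.
Proof.
have fg : finitely_generated ('rV[A]_0).
  exists 0%N, (fun=> 0) => x; exists (fun=> 0).
  by rewrite big_ord0 [x]thinmx0.
by exists (FgMod fg) => x; apply: thinmx0.
Qed.

Lemma rank_at_complement X e : idempotent_elt e ->
  (rank_at X e + rank_at X (1 - e)%R)%N = \dim {:kmod X}.
Proof.
move=> ee; rewrite -(limg_ker_dim (lact X e) fullv) capfv addnC.
congr (\dim _ + _)%N; apply/vspaceP => x; rewrite mem_limg_idem; last first.
  by rewrite /idempotent_elt mulrBr mulr1 mulrBl mul1r ee subrr subr0.
by rewrite memv_ker lactE actB act1 -subr_eq0 addrAC subrr sub0r oppr_eq0.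
Qed.

Lemma sum_of_modules (C : subcategory A) m (r : 'I_m -> A -> nat) (c : 'I_m -> nat) :
  contains_zero C -> extension_closed C ->
  (forall i, exists X, C X /\ forall e, idempotent_elt e -> rank_at X e = r i e) ->
  exists X, C X /\
    forall e, idempotent_elt e -> rank_at X e = (\sum_i c i * r i e)%N.
Proof.
move=> C0 Ce; have [Z0 zZ0] := zero_module_exists.
have rZ0 e : rank_at Z0 e = 0%N by apply/rank_at_eq0 => x; apply: zZ0.
have add X Y : C X -> C Y -> exists Z : fgmodType A, C Z /\
    forall e, idempotent_elt e -> rank_at Z e = (rank_at X e + rank_at Y e)%N.
  move=> CX CY; have [Z [f [g fg]]] := direct_sum_exact X Y.
  by exists Z; split=> [|e ee]; [apply: Ce fg CX CY|apply: rank_at_exact fg ee].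
have mul X k : C X -> exists Z : fgmodType A, C Z /\
    forall e, idempotent_elt e -> rank_at Z e = (k * rank_at X e)%N.
  move=> CX; elim: k => [|k [Z [CZ rZ]]]; first by exists Z0; split; [apply: C0|].
  have [Z' [CZ' rZ']] := add _ _ CX CZ; exists Z'; split=> // e ee.
  by rewrite rZ' // rZ // mulSn.
elim: m r c => [|m IHm] r c rX.
  by exists Z0; split=> [|e ee]; [apply: C0|rewrite big_ord0].
have [X [CX rkX]] := IHm _ (fun i => c (lift ord0 i)) (fun i => rX (lift ord0 i)).
have [X0 [CX0 rkX0]] := rX ord0; have [Y [CY rkY]] := mul _ (c ord0) CX0.
have [Z [CZ rkZ]] := add _ _ CY CX; exists Z; split=> // e ee.
by rewrite rkZ // rkY // rkX0 // rkX // big_ord_recl.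
Qed.

(** Negative coefficients of an integer combination of ranks are traded for
    complementary idempotents and a multiple of the dimension. *)
Lemma positive_combination (z : seq (int * A)) :
  (forall ke, ke \in z -> idempotent_elt ke.2) ->
  exists (n : nat) (s : seq A), (forall e, e \in s -> idempotent_elt e) /\
    forall X, \sum_(ke <- z) ke.1 * (rank_at X ke.2)%:Z =
      \sum_(e <- s) (rank_at X e)%:Z - (n * \dim {:kmod X})%:Z.
Proof.
elim: z => [|[k e] z IHz] idz.
  by exists 0%N, [::]; split=> // X; rewrite !big_nil subr0.
have [|n [s [ids sE]]] := IHz; first by move=> ke kez; apply: idz; rewrite inE kez orbT.
have ee : idempotent_elt e by apply: (idz (k, e)); rewrite mem_head.
have sum_nseq (m : nat) (f : A) X :
    \sum_(e <- nseq m f) (rank_at X e)%:Z = m%:Z * (rank_at X f)%:Z.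
  by rewrite big_nseq iter_addr_0 -mulr_natl natz.
case: k idz => m idz.
  exists n, (nseq m e ++ s); split=> [f|X].
    by rewrite mem_cat mem_nseq => /orP[/andP[_ /eqP ->]|/ids].
  by rewrite big_cons big_cat sE sum_nseq /= addrA.
exists (n + m.+1)%N, (nseq m.+1 (1 - e) ++ s); split=> [f|X].
  rewrite mem_cat mem_nseq => /orP[/andP[_ /eqP ->]|/ids //].
  by rewrite /idempotent_elt mulrBr mulr1 mulrBl mul1r ee subrr subr0.
rewrite big_cons big_cat sE sum_nseq /= mulnDl PoszD NegzE.
rewrite -(rank_at_complement X ee) !PoszM !PoszD; ring.
Qed.

(** The dimension vectors at stake are those of the nonzero quotients of M and
    of the nonzero submodules of N, finitely many. A nonnegative relation
    between the former and the opposites of the latter would be an equality of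
    ranks between a module of T and one of its right orthogonal, nonzero by
    looking at the idempotent 1; so Gordan's alternative provides an integral
    combination of ranks separating them. *)
Lemma numerical_separation (T : subcategory A) (M N : fgmodType A) :
  torsion_class T -> T M -> right_perp T N -> numerically_disjoint T ->
  torsion_free_class (right_perp T) ->
  exists (n : nat) (s : seq A), [/\ forall e, e \in s -> idempotent_elt e,
    forall (Q : fgmodType A) (p : {linear M -> Q}), surjective p -> ~ zero_module Q ->
      (n * \dim {:kmod Q} < \sum_(e <- s) rank_at Q e)%N
  & forall (W : fgmodType A) (i : {linear W -> N}), injective i -> ~ zero_module W ->
      (\sum_(e <- s) rank_at W e < n * \dim {:kmod W})%N].
Proof.
move=> [T0 _ Tq Te] TM FN disj [F0 _ Fs Fe].
have [s1 [s1P s1_rep]] := finite_representatives (X := M) (fun Z => Z != fullv).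
have [s2 [s2P s2_rep]] := finite_representatives (X := N) (fun Z => Z != 0%VS).
pose r1 (i : 'I_(size s1)) e := (rank_at M e - \dim (lact M e @: nth 0%VS s1 i))%N.
pose r2 (i : 'I_(size s2)) e := \dim (lact N e @: nth 0%VS s2 i).
have rankQ (Q : fgmodType A) (p : {linear M -> Q}) (Z : {vspace kmod M}) e :
    surjective p ->
    (forall x : kmod M, x \in Z <-> p x = 0) -> stable Z -> idempotent_elt e ->
    rank_at Q e = (rank_at M e - \dim (lact M e @: Z))%N.
  move=> p_surj pZ stZ ee; have [Y [i [i_inj iZ]]] := submodule_exists stZ.
  have ip : short_exact i p by apply: short_exactI pZ.
  by rewrite (rank_at_exact ip ee) (rank_at_inj e i_inj (limg_klin iZ)) addKn.
have r1_mod i : exists X, T X /\ forall e, idempotent_elt e -> rank_at X e = r1 i e.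
  have [stZ _] := s1P _ (mem_nth 0%VS (ltn_ord i)).
  have [Q [p [p_surj pZ]]] := quotient_exists stZ.
  by exists Q; split=> [|e]; [apply: Tq p_surj TM|apply: rankQ].
have r2_mod i : exists X, right_perp T X /\
    forall e, idempotent_elt e -> rank_at X e = r2 i e.
  have [stZ _] := s2P _ (mem_nth 0%VS (ltn_ord i)).
  have [W [j [j_inj jZ]]] := submodule_exists stZ.
  exists W; split=> [|e _]; first by apply: Fs j_inj FN.
  by rewrite (rank_at_inj e j_inj (limg_klin jZ)).
have id1 : idempotent_elt (1 : A) by rewrite /idempotent_elt mulr1.
have r1_gt0 i : (0 < r1 i 1%R)%N.
  have [stZ Z_neq] := s1P _ (mem_nth 0%VS (ltn_ord i)).
  rewrite subn_gt0 rank_at1 ltn_neqAle dimvS ?subvf // andbT.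
  apply: contraNneq Z_neq => eq_dim; rewrite eqEdim subvf /= -eq_dim.
  by apply: dimvS; apply/subvP => _ /memv_imgP [x xZ ->]; rewrite lactE act1.
have r2_gt0 i : (0 < r2 i 1%R)%N.
  have [stZ Z_neq] := s2P _ (mem_nth 0%VS (ltn_ord i)).
  rewrite lt0n; apply: contra Z_neq; rewrite !dimv_eq0 -!subv0 => /subvP Z0.
  by apply/subvP => x xZ; rewrite -[x]act1 -lactE Z0 ?memv_img.
pose m := (size s1 + size s2)%N.
pose r (i : 'I_m) e : int :=
  match split i with inl i => (r1 i e)%:Z | inr i => - (r2 i e)%:Z end.
have rL i e : r (lshift _ i) e = (r1 i e)%:Z by rewrite /r (unsplitK (inl i)).
have rR i e : r (rshift _ i) e = - (r2 i e)%:Z by rewrite /r (unsplitK (inr i)).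
pose Phi (phi : 'I_m -> int) := exists2 z : seq (int * A),
  (forall ke, ke \in z -> idempotent_elt ke.2) &
  phi = fun i => \sum_(ke <- z) ke.1 * r i ke.2.
have [|a b phi psi [z1 id1z ->] [z2 id2z ->]|[_ [z idz ->] z_gt0]
  |[c [c_ge0 [i0 ci0] c_rel]]] := @gordan_alternative m Phi.
- by exists [::] => //; apply/funext => i; rewrite big_nil.
- exists ([seq (a * ke.1, ke.2) | ke <- z1] ++ [seq (b * ke.1, ke.2) | ke <- z2]).
    move=> ke; rewrite mem_cat => /orP[] /mapP [ke' ke'z ->] /=; first exact: id1z.
    exact: id2z.
  apply/funext => i; rewrite big_cat !big_map !mulr_sumr /=.
  by congr (_ + _); apply: eq_bigr => ke _; rewrite mulrA.
- have [n [s [ids sE]]] := positive_combination idz.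
  exists n, s; split=> // [Q p p_surj Q_neq0|W i i_inj W_neq0].
    pose Z := lker (klin p).
    have pZ (x : kmod M) : x \in Z <-> p x = 0 by rewrite memv_ker klinE; split=> /eqP.
    have stZ : stable Z by apply: stable_lker.
    have Z_neq : Z != fullv.
      apply/eqP => Zf; case: Q_neq0 => y; have [x <-] := p_surj y.
      by apply/pZ; rewrite Zf memvf.
    have [Z' Z's eqZ] := s1_rep Z stZ Z_neq.
    have ltZ' : (index Z' s1 < size s1)%N by rewrite index_mem.
    have nthZ' : nth 0%VS s1 (index Z' s1) = Z' by exact: nth_index.
    have r1E e : r1 (Ordinal ltZ') e = (rank_at M e - \dim (lact M e @: Z'))%N.
      exact: (congr1 (fun V => (rank_at M e - \dim (lact M e @: V))%N) nthZ').
    have /= := z_gt0 (lshift _ (Ordinal ltZ')); under eq_bigr => ke _ do rewrite rL.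
    have -> : \sum_(ke <- z) ke.1 * (r1 (Ordinal ltZ') ke.2)%:Z =
        \sum_(ke <- z) ke.1 * (rank_at Q ke.2)%:Z.
      rewrite big_seq [RHS]big_seq; apply: eq_bigr => ke kez.
      have ide := idz ke kez.
      by rewrite (rankQ Q p Z _ p_surj pZ stZ ide) r1E (eqZ _ ide).
    by rewrite sE subr_gt0 -(big_morph Posz PoszD (erefl _)) ltz_nat.
  pose Z := limg (klin i).
  have stZ : stable Z by apply: stable_limg.
  have Z_neq : Z != 0%VS.
    apply/eqP => Z0; case: W_neq0 => w; apply: i_inj; rewrite linear0.
    by apply/eqP; rewrite -(@memv0 _ (kmod N)) -Z0 -[i w]klinE memv_img ?memvf.
  have [Z' Z's eqZ] := s2_rep Z stZ Z_neq.
  have ltZ' : (index Z' s2 < size s2)%N by rewrite index_mem.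
  have nthZ' : nth 0%VS s2 (index Z' s2) = Z' by exact: nth_index.
  have r2E e : r2 (Ordinal ltZ') e = \dim (lact N e @: Z').
    exact: (congr1 (fun V => \dim (lact N e @: V)) nthZ').
  have /= := z_gt0 (rshift _ (Ordinal ltZ')); under eq_bigr => ke _ do rewrite rR mulrN.
  have -> : \sum_(ke <- z) - (ke.1 * (r2 (Ordinal ltZ') ke.2)%:Z) =
      - \sum_(ke <- z) ke.1 * (rank_at W ke.2)%:Z.
    rewrite -sumrN big_seq [RHS]big_seq; apply: eq_bigr => ke kez.
    by have ide := idz ke kez; rewrite (rank_at_inj _ i_inj erefl) (eqZ _ ide) r2E.
  by rewrite sE opprB subr_gt0 -(big_morph Posz PoszD (erefl _)) ltz_nat.
case: disj.
have [X [TX rkX]] := sum_of_modules (fun i => `|c (lshift _ i)|%N) T0 Te r1_mod.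
have [Y [FY rkY]] := sum_of_modules (fun i => `|c (rshift _ i)|%N) F0 Fe r2_mod.
have eqXY e : idempotent_elt e -> rank_at X e = rank_at Y e.
  move=> ee; rewrite rkX // rkY //; apply/eqP; rewrite -eqz_nat; apply/eqP.
  have /c_rel : Phi (fun i => r i e).
    exists [:: (1, e)] => [ke|]; first by rewrite inE => /eqP ->.
    by apply/funext => i; rewrite big_seq1 mul1r.
  rewrite big_split_ord /= => /eqP; rewrite addr_eq0 -sumrN => /eqP eq_c.
  rewrite !(big_morph Posz PoszD (erefl _)).
  transitivity (\sum_(i < size s1) c (lshift (size s2) i) * r (lshift (size s2) i) e).
    by apply: eq_bigr => i _; rewrite rL PoszM gez0_abs.
  rewrite eq_c; apply: eq_bigr => i _.
  by rewrite rR PoszM gez0_abs // mulrN opprK.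
exists X, Y; split=> //; first exact: K0_eq_of_ranks.
move=> /K0_dim_eq /= /eqP; rewrite -rank_at1 => /eqP [X0].
case: (split_ordP i0) => i eq_i; move: ci0; rewrite eq_i => ci_gt0.
  move: X0; rewrite rkX // (bigD1 i) //= => /eqP; rewrite addn_eq0 muln_eq0.
  by rewrite absz_eq0 gt_eqF // eqn0Ngt r1_gt0.
move: X0; rewrite eqXY // rkY // (bigD1 i) //= => /eqP; rewrite addn_eq0 muln_eq0.
by rewrite absz_eq0 gt_eqF // eqn0Ngt r2_gt0.
Qed.

End Separation.

(** * Torsion classes attached to a map of projectives *)

Section Classes.
Variables (K : fieldType) (A : falgType K).
Implicit Types X Y Z : fgmodType A.

Lemma bijective_inverse X Y (f : {linear X -> Y}) : bijective f ->
  exists g : {linear Y -> X}, injective g.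
Proof.
move=> [f' fK f'K].
have [|g gE] := factor_injective (f := idfun : {linear Y -> Y}) (can_inj fK).
  by move=> y; exists (f' y); rewrite f'K.
by exists g => y z eq_yz; rewrite -[y]gE eq_yz gE.
Qed.

Lemma bijective_surjective X Y (f : {linear X -> Y}) : bijective f -> surjective f.
Proof. by move=> [f' _ f'K] y; exists (f' y); rewrite f'K. Qed.

Lemma right_perp_torsion_free (T : subcategory A) : torsion_free_class (right_perp T).
Proof.
have sub : submodule_closed (right_perp T).
  move=> X Y f f_inj FY W TW g w; apply: f_inj; rewrite linear0.
  exact: (FY W TW (f \o g)).
split=> // [Y Y0 W TW g w|X Y [f /bijective_inverse [g g_inj]]|X Y Z f g].
- exact: Y0.
- exact: sub g_inj.
move=> [f_inj g_surj fg] FX FZ W TW h w.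
have [|h' h'E] := factor_injective (f := h) f_inj.
  by move=> w'; apply/fg; apply: (FZ W TW (g \o h)).
by rewrite -h'E (FX W TW h') linear0.
Qed.

(** A submodule of an extension is an extension of submodules, and weights are
    additive. *)
Lemma negative_weight_torsion_free (n : nat) (s : seq A) :
  (forall e, e \in s -> idempotent_elt e) ->
  torsion_free_class (fun Y : fgmodType A =>
    forall (W : fgmodType A) (i : {linear W -> Y}), injective i -> ~ zero_module W ->
      (\sum_(e <- s) rank_at W e < n * \dim {:kmod W})%N).
Proof.
move=> ids; set C := (C in torsion_free_class C).
have sub : submodule_closed C.
  by move=> X Y f f_inj CY W i i_inj; apply: (CY W (f \o i)); apply: inj_comp.
split=> // [Y Y0 W i i_inj []|X Y [f /bijective_inverse [g g_inj]]|X Y Z f g].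
- by move=> w; apply: i_inj; rewrite linear0; apply: Y0.
- exact: sub g_inj.
move=> [f_inj g_surj fg] CX CZ W i i_inj W_neq0.
have [W1 [W2 [j [p [jp _ jp0]]]]] :=
  stable_exact (stable_lker (f := g \o i : {linear W -> Z})).
have kerP (w : W) : p w = 0 <-> g (i w) = 0.
  by rewrite -(jp0 w) memv_ker klinE; split=> /eqP.
have [j_inj p_surj jpE] := jp.
have [|j' j'E] := factor_injective (f := i \o j : {linear W1 -> Y}) f_inj.
  by move=> w; apply/fg/kerP/jpE; exists w.
have [|p' p'E] := factor_surjective (g := g \o i : {linear W -> Z}) p_surj.
  by move=> w /kerP.
have j'_inj : injective j'.
  by move=> w w' eq_w; apply/j_inj/i_inj; have /= := j'E w; rewrite eq_w j'E.
have p'_inj : injective p'.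
  move=> w w' eq_w; have [v pv] := p_surj w; have [v' pv'] := p_surj w'.
  apply/eqP; rewrite -subr_eq0 -pv -pv' -linearB; apply/eqP/kerP.
  by have := p'E (v - v'); rewrite /= => <-; rewrite !linearB /= pv pv' eq_w subrr.
have rk e : idempotent_elt e -> rank_at W e = (rank_at W1 e + rank_at W2 e)%N.
  exact: rank_at_exact jp.
have id1 : idempotent_elt (1 : A) by rewrite /idempotent_elt mulr1.
have -> : (\sum_(e <- s) rank_at W e =
    \sum_(e <- s) rank_at W1 e + \sum_(e <- s) rank_at W2 e)%N.
  rewrite -big_split big_seq [RHS]big_seq; apply: eq_bigr => e es.
  by rewrite rk //; apply: ids.
rewrite -rank_at1 rk // !rank_at1 mulnDr.
have le0 (V : fgmodType A) : zero_module V -> forall e, rank_at V e = 0%N.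
  by move=> V0 e; apply/rank_at_eq0 => x; apply: V0.
have [W1_0|W1_neq0] := pselect (zero_module W1).
  have [W2_0|W2_neq0] := pselect (zero_module W2).
    case: W_neq0; apply/zero_moduleP; rewrite -rank_at1 rk //.
    by rewrite !le0.
  have lt2 := CZ W2 p' p'_inj W2_neq0.
  rewrite [X in (X + _)%N]big1 => [|e _]; last exact: (le0 _ W1_0).
  by rewrite add0n; apply: leq_trans lt2 _; rewrite leq_addl.
have lt1 := CX W1 j' j'_inj W1_neq0.
have [W2_0|W2_neq0] := pselect (zero_module W2).
  rewrite [X in (_ + X)%N]big1 => [|e _]; last exact: (le0 _ W2_0).
  by rewrite addn0; apply: leq_trans lt1 _; rewrite leq_addr.
by have := CZ W2 p' p'_inj W2_neq0; lia.
Qed.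

End Classes.

Section Presentation.
Variables (K : fieldType) (A : falgType K).
Implicit Types X Y Z : fgmodType A.
Variables (I1 I2 : finType) (F : I1 -> I2 -> A) (E : I2 -> A).
Hypothesis E_idem : forall v, idempotent_elt (E v).
Hypothesis FE : forall u v, F u v * E v = F u v.

(** For projectives P1 = A^I1 and P0, the sum over v of A (E v), a map P1 ->
    P0 is a matrix F with F u v E v = F u v. Identifying maps out of A e with
    e-fixed elements, Fmul is composition with F, from Hom(P0, X) to Hom(P1,
    X). *)
Definition Fmul X (y : I2 -> kmod X) (u : I1) : kmod X := \sum_v act (F u v) (y v).

(** Every map P1 -> X factors through P0; as F absorbs E, the factorisation
    may be given by any tuple. *)
Definition solvable X := forall x : I1 -> kmod X, exists y, forall u, x u = Fmul y u.

(** Maps P0 -> X are determined by their restriction to P1. *)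
Definition separated X := forall y : I2 -> kmod X,
  (forall v, act (E v) (y v) = y v) -> (forall u, Fmul y u = 0) -> forall v, y v = 0.

Lemma Fmul_klin X Y (f : {linear X -> Y}) y u :
  klin f (Fmul y u) = Fmul (fun v => klin f (y v)) u.
Proof. by rewrite linear_sum; apply: eq_bigr => v _ /=; rewrite klin_act. Qed.

Lemma FmulD X (y y' : I2 -> kmod X) u :
  Fmul (fun v => y v + y' v) u = Fmul y u + Fmul y' u.
Proof. by rewrite /Fmul -big_split; apply: eq_bigr => v _; rewrite linearD. Qed.

Lemma Fmul_sum X (J : finType) (c : J -> K) (y : J -> I2 -> kmod X) u :
  Fmul (fun v => \sum_r c r *: y r v) u = \sum_r c r *: Fmul (y r) u.
Proof.
rewrite /Fmul; under [RHS]eq_bigr => r _ do rewrite scaler_sumr.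
rewrite exchange_big; apply: eq_bigr => v _ /=; rewrite linear_sum.
by apply: eq_bigr => r _; rewrite linearZ.
Qed.

Lemma FmulE X (y : I2 -> kmod X) u : Fmul (fun v => act (E v) (y v)) u = Fmul y u.
Proof. by apply: eq_bigr => v _; rewrite -actM FE. Qed.

(** Systems with values in X are solved in Y and not in X: this is what the
    pushout in the left approximation provides, where X itself is arbitrary. *)
Lemma solvable_extension X Y Z (f : {linear X -> Y}) (g : {linear Y -> Z}) :
  (forall y, g y = 0 -> exists x, f x = y) -> surjective g ->
  (forall x : I1 -> kmod X, exists y : I2 -> kmod Y,
     forall u, klin f (x u) = Fmul y u) ->
  solvable Z -> solvable Y.
Proof.
move=> fg g_surj solX solZ x.
have [z zE] := solZ (fun u => klin g (x u)).
have /choice [y0 y0E] : forall v, exists y : kmod Y, klin g y = z v.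
  by move=> v; have [y <-] := g_surj (z v); exists y; rewrite klinE.
have /choice [w wE] : forall u, exists w : X, f w = x u - Fmul y0 u.
  move=> u; apply: fg; rewrite -klinE linearB /= Fmul_klin zE; apply/eqP.
  by rewrite subr_eq0; apply/eqP/eq_bigr => v _; rewrite y0E.
have [y1 y1E] := solX w; exists (fun v => y1 v + y0 v) => u.
by rewrite FmulD -y1E klinE wE subrK.
Qed.

Lemma solvable_torsion : torsion_class solvable.
Proof.
have quo : quotient_closed solvable.
  move=> X Y f f_surj solX y.
  have /choice [x xE] : forall u, exists x : X, f x = y u by move=> u; apply: f_surj.
  have [w wE] := solX x; exists (fun v => klin f (w v)) => u.
  by rewrite -xE -Fmul_klin -wE klinE.
split=> // [X X0 x|X Y [f /bijective_surjective f_surj]|X Y Z f g].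
- exists (fun=> 0) => u; rewrite [LHS]X0 /Fmul big1 // => v _; exact: linear0.
- exact: quo f_surj.
move=> [f_inj g_surj fg] solX; apply: (@solvable_extension _ _ _ f g) => //.
  by move=> y /fg.
move=> x; have [y yE] := solX x; exists (fun v => klin f (y v)) => u.
by rewrite yE Fmul_klin.
Qed.

Lemma separated_torsion_free : torsion_free_class separated.
Proof.
have sub : submodule_closed separated.
  move=> X Y f f_inj sepY y Ey Fy v; apply: f_inj; rewrite linear0 -klinE.
  apply: (sepY (fun v => klin f (y v))) => [w|u].
    by rewrite -klin_act Ey.
  by rewrite -Fmul_klin Fy linear0.
split=> // [X X0 y _ _ v|X Y [f /bijective_inverse [g g_inj]]|X Y Z f g].
- exact: X0.
- exact: sub g_inj.
move=> [f_inj g_surj fg] sepX sepZ y Ey Fy.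
have /choice [x xE] : forall v, exists x : X, f x = y v.
  move=> v; apply/fg; rewrite -klinE.
  apply: (sepZ (fun v => klin g (y v))) => [w|u].
    by rewrite -klin_act Ey.
  by rewrite -Fmul_klin Fy linear0.
have xE' v : klin f (x v) = y v by rewrite klinE.
have klin_inj : injective (klin f) by move=> a b; rewrite !klinE; apply: f_inj.
move=> v; rewrite -xE'; suff -> : x v = 0 by rewrite linear0.
apply: (sepX x) => [w|u]; apply: klin_inj; first by rewrite klin_act xE' Ey.
rewrite Fmul_klin linear0 -[RHS](Fy u); apply: eq_bigr => w _; by rewrite xE'.
Qed.

Lemma generated_submodule X (J : finType) (g : J -> kmod X) :
  exists U : {vspace kmod X}, [/\ stable U, forall i, g i \in U
    & forall Z (f : {linear X -> Z}), (forall i, f (g i) = 0) ->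
        forall x, x \in U -> f x = 0].
Proof.
have ev_lin i : linear (fun a : A => act a (g i)).
  by move=> c a b; rewrite actD actZ.
have /choice [ev evE] : forall i, exists H : 'Hom(A, kmod X),
    forall a, H a = act a (g i).
  by move=> i; have [H HE] := linear_hom (ev_lin i); exists H.
exists (\sum_i limg (ev i))%VS; split.
- move=> a _ /memv_sumP [w wU ->]; rewrite linear_sum /=.
  apply: memv_sumr => i _; have /memv_imgP [b _ ->] := wU i isT.
  by rewrite evE -actM -evE memv_img ?memvf.
- move=> i; apply: (subvP (sumv_sup i _ (subvv _))) => //.
  by rewrite -[g i]act1 -evE memv_img ?memvf.
move=> Z f fg x /memv_sumP [w wU ->]; rewrite -klinE linear_sum big1 // => i _.
have /memv_imgP [b _ ->] := wU i isT.
by rewrite evE /= klin_act klinE fg linear0.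
Qed.

End Presentation.

(** * Approximations *)

Section Approximation.
Variables (K : fieldType) (A : falgType K).
Implicit Types X Y Z : fgmodType A.
Variables (I1 I2 : finType) (F : I1 -> I2 -> A) (E : I2 -> A).
Hypothesis E_idem : forall v, idempotent_elt (E v).
Hypothesis FE : forall u v, F u v * E v = F u v.

Lemma free_module_fg (n : nat) : finitely_generated ('rV[A]_n).
Proof.
exists n, (fun i => delta_mx 0 i) => x; exists (x 0).
exact: row_sum_delta.
Qed.

(** Pushout of X along the maps P1 -> P0, one copy for each r, glued by the
    tuple b r. *)
Lemma universal_extension X (J : finType) (b : J -> I1 -> kmod X) :
  exists (X' : fgmodType A) (iota : {linear X -> X'}) (c : J -> I2 -> kmod X'),
    [/\ forall r u, klin iota (b r u) = Fmul F (c r) u,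
        forall r v, act (E v) (c r v) = c r v,
        forall x' : kmod X', exists (x : X) (a : J -> I2 -> A),
          x' = klin iota x + \sum_r \sum_v act (a r v) (c r v)
      & forall Z (f : {linear X -> Z}) (c' : J -> I2 -> kmod Z),
          (forall r u, klin f (b r u) = Fmul F (c' r) u) ->
          (forall r v, act (E v) (c' r v) = c' r v) ->
          exists h : {linear X' -> Z}, forall x, h (iota x) = f x].
Proof.
pose N := #|{: J * I2}|; pose P := FgMod (free_module_fg N).
pose Q := FgMod (product_fg X P).
pose eps r v : kmod Q := (0, delta_mx 0 (enum_rank (r, v))).
pose emb (x : X) : kmod Q := (x, 0).
pose rel (k : (J * I1) + (J * I2)) : kmod Q := match k with
  | inl ru => emb (b ru.1 ru.2) - Fmul F (eps ru.1) ru.2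
  | inr rv => act (E rv.2) (eps rv.1 rv.2) - eps rv.1 rv.2 end.
have [U [stU relU U_min]] := generated_submodule rel.
have [X' [p [p_surj pU]]] := quotient_exists stU.
have emb_lin : linear (p \o emb).
  move=> a x y; rewrite /= -linearP; congr (p _).
  by apply: injective_projections; rewrite /= ?scaler0 ?addr0.
have [iota iotaE] := @linear_exists _ X X' _ emb_lin.
exists X', iota, (fun r v => klin p (eps r v)).
have p_rel k : klin p (rel k) = 0 by rewrite klinE; apply/pU.
split.
- move=> r u; rewrite klinE iotaE /= -Fmul_klin -[p _]klinE; apply/eqP.
  by rewrite -subr_eq0 -linearB; apply/eqP; apply: (p_rel (inl (r, u))).
- move=> r v; rewrite -klin_act; apply/eqP.
  by rewrite -subr_eq0 -linearB; apply/eqP; apply: (p_rel (inr (r, v))).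
- move=> x'; have [[x q] <-] := p_surj x'.
  exists x, (fun r v => q 0 (enum_rank (r, v))).
  rewrite klinE iotaE /= -[p (emb x)]klinE.
  under eq_bigr => r _ do under eq_bigr => v _ do rewrite -klin_act.
  under eq_bigr => r _ do rewrite -linear_sum /=.
  rewrite -linear_sum -linearD /= klinE; congr (p _).
  have -> : \sum_r \sum_v act (q 0 (enum_rank (r, v))) (eps r v) = (0, q) :> Q.
    rewrite pair_bigA /= (reindex_onto enum_val enum_rank) /= => [|i _];
      last exact: enum_rankK.
    apply: injective_projections.
      rewrite (big_morph fst (id1 := 0) (op1 := +%R)) // big1 // => i _ /=.
      by rewrite /act scaler0.
    rewrite (big_morph snd (id1 := 0) (op1 := +%R)) //= [RHS]row_sum_delta.
    apply: eq_big => i; first by rewrite enum_valK eqxx.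
    by rewrite -surjective_pairing enum_valK.
  by apply: injective_projections; rewrite /= ?addr0 ?add0r.
move=> Z f c' fb Ec'.
pose g (y : Q) : Z := f y.1 + \sum_r \sum_v y.2 0 (enum_rank (r, v)) *: (c' r v : Z).
have g_lin : linear g.
  move=> a x y; rewrite /g linearP scalerDr scaler_sumr addrACA; congr (_ + _).
  rewrite -big_split; apply: eq_bigr => r _ /=; rewrite scaler_sumr -big_split.
  by apply: eq_bigr => v _ /=; rewrite !mxE scalerDl scalerA.
have [g' g'E] := linear_exists g_lin.
have g_eps r v : klin g' (eps r v) = c' r v.
  rewrite klinE g'E /g /= linear0 add0r (bigD1 r) //= (bigD1 v) //=.
  rewrite !mxE !eqxx scale1r !big1 ?addr0 // => [s neq_s|w neq_w].
    apply: big1 => w _; rewrite mxE (inj_eq enum_rank_inj) xpair_eqE.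
    by rewrite (negPf neq_s) andbF scale0r.
  rewrite mxE (inj_eq enum_rank_inj) xpair_eqE (negPf neq_w) !andbF scale0r //.
have g_emb x : klin g' (emb x) = f x.
  rewrite klinE g'E /g /= big1 ?addr0 // => r _; rewrite big1 // => v _.
  by rewrite mxE scale0r.
have g_rel k : g' (rel k) = 0.
  rewrite -klinE; case: k => [[r u]|[r v]] /=; rewrite linearB /=.
    rewrite g_emb Fmul_klin; apply/eqP; rewrite subr_eq0 -klinE fb.
    by apply/eqP/eq_bigr => v _; rewrite g_eps.
  by rewrite klin_act g_eps Ec' subrr.
have [|h hE] := factor_surjective (g := g') p_surj.
  by move=> y /pU; apply: U_min.
by exists h => x; rewrite iotaE /= hE -klinE g_emb.
Qed.

Variable T : subcategory A.
Hypothesis T_torsion : torsion_class T.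
Hypothesis T_solvable : forall X, T X <-> solvable F X.
Hypothesis perp_separated : forall Y, right_perp T Y -> separated F E Y.

(** The torsion-free part of Z is such a quotient. *)
Lemma torsion_of_no_quotient Z :
  (forall Y (q : {linear Z -> Y}), surjective q -> right_perp T Y -> zero_module Y) ->
  T Z.
Proof.
move=> noQ.
have [Y [Q [i [q [[i_inj q_surj iq] TY FQ]]]]] := torsion_sequence Z T_torsion.
have Q0 := noQ Q q q_surj FQ; have [_ _ Tq _] := T_torsion.
by apply: (Tq Y Z i) => // z; apply/iq/Q0.
Qed.

(** Push X out along a basis of Hom(P1, X). The result is universal for maps
    into solvable modules. It is solvable: systems with values in the image of
    X become solvable by construction, and the cokernel Z of X -> X' is in T
    because any torsion-free quotient of Z is generated by solutions of the
    homogeneous system, which vanish there. *)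
Lemma left_approximation_exists X :
  exists (X' : fgmodType A) (f : {linear X -> X'}), left_approximation T f.
Proof.
pose V := {ffun I1 -> kmod X}; pose B := vbasis {:V}.
have [X' [iota [c [iota_b Ec gen univ]]]] :=
  universal_extension (fun r : 'I_(\dim {:V}) => B`_r : V).
exists X', iota; split; last first.
  move=> Z g /T_solvable solZ.
  have /choice [w wE] : forall r, exists w : I2 -> kmod Z,
      forall u, klin g ((B`_r : V) u) = Fmul F w u.
    by move=> r; have [w wE] := solZ (fun u => klin g ((B`_r : V) u)); exists w.
  have [||h hE] := univ Z g (fun r v => act (E v) (w r v)).
  - by move=> r u; rewrite FmulE.
  - by move=> r v; rewrite -actM E_idem.
  by exists h => x; rewrite hE.
apply/T_solvable.
have [Z [p [p_surj pU]]] := quotient_exists (stable_limg (f := iota)).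
have p_iota x : klin p (klin iota x) = 0.
  by rewrite klinE; apply/pU; rewrite memv_img ?memvf.
have TZ : T Z.
  apply: torsion_of_no_quotient => Y q q_surj FY y.
  have [z <-] := q_surj y; have [x' <-] := p_surj z.
  have c0 r v : klin q (klin p (c r v)) = 0.
    apply: (perp_separated FY (y := fun v => klin q (klin p (c r v))) _ _ v).
      by move=> w; rewrite -!klin_act Ec.
    by move=> u; rewrite -!Fmul_klin -iota_b p_iota linear0.
  have [x [a ->]] := gen x'; rewrite -[q _]klinE -[p _]klinE !linearD /=.
  rewrite p_iota linear0 add0r.
  rewrite !linear_sum big1 // => r _; rewrite !linear_sum big1 // => v _ /=.
  by rewrite !klin_act c0 linear0.
apply: (solvable_extension (f := iota) (g := p)) => // [y py0|x|].
- by have /memv_imgP [x _ ->] : (y : kmod X') \in limg (klin iota);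
    [apply/pU|exists x; rewrite klinE].
- pose x' : V := [ffun u => x u].
  exists (fun v => \sum_r coord B r x' *: c r v) => u.
  rewrite Fmul_sum -[x u](ffunE x) -/x' {1}(coord_vbasis (memvf x')).
  rewrite sum_ffunE linear_sum; apply: eq_bigr => r _ /=.
  by rewrite ffunE linearZ /= iota_b.
by apply/T_solvable.
Qed.

(** The torsion part of X is a right approximation. *)
Lemma right_approximation_exists X :
  exists (X' : fgmodType A) (f : {linear X' -> X}), right_approximation T f.
Proof.
have [Y [Z [i [p [[i_inj p_surj ip] TY FZ]]]]] := torsion_sequence X T_torsion.
exists Y, i; split=> // W g TW.
have [|h hE] := factor_injective (f := g) i_inj.
  by move=> w; apply/ip; apply: (FZ W TW (p \o g)).
by exists h.
Qed.

End Approximation.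

(** * Existence of the map of projectives *)

Section ProductSpace.
Variables (K : fieldType) (V : vectType K) (J : finType).

Definition inj_at (i : J) (v : V) : {ffun J -> V} :=
  [ffun k => if k == i then v else 0].
Fact inj_at_linear i : linear (inj_at i).
Proof.
move=> a u v; apply/ffunP => k; rewrite !ffunE.
by case: eqP; rewrite ?scaler0 ?addr0.
Qed.
HB.instance Definition _ i :=
  GRing.isLinear.Build K V {ffun J -> V} _ (inj_at i) (inj_at_linear i).

Definition box (U : J -> {vspace V}) : {vspace {ffun J -> V}} :=
  (\sum_i linfun (inj_at i) @: U i)%VS.

Lemma sum_inj_at (y : {ffun J -> V}) : y = \sum_i inj_at i (y i).
Proof.
apply/ffunP => k; rewrite sum_ffunE (bigD1 k) //= ffunE eqxx big1 ?addr0 //.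
by move=> i /negPf neq_i; rewrite ffunE eq_sym neq_i.
Qed.

Lemma mem_box U y : y \in box U <-> forall i, y i \in U i.
Proof.
split=> [/memv_sumP [w wU ->] i|yU].
  rewrite sum_ffunE (bigD1 i) //= rpredD //.
    by have /memv_imgP [u uU ->] := wU i isT; rewrite lfunE ffunE eqxx.
  apply: rpred_sum => k /negPf neq_k; have /memv_imgP [u uU ->] := wU k isT.
  by rewrite lfunE ffunE eq_sym neq_k mem0v.
rewrite (sum_inj_at y); apply: memv_sumr => i _.
by apply/memv_imgP; exists (y i); rewrite ?lfunE.
Qed.

Lemma dim_box U : \dim (box U) = (\sum_i \dim (U i))%N.
Proof.
have /directvP -> : directv (\sum_i linfun (inj_at i) @: U i).
  apply/directv_sum_independent => us usU sum0 i _.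
  have /memv_imgP [u uU usE] := usU i isT.
  have := congr1 (fun y : {ffun J -> V} => y i) sum0.
  rewrite sum_ffunE (bigD1 i) //= big1 ?addr0 => [|k /negPf neq_k].
    by rewrite usE !lfunE ffunE eqxx ffunE => ->; rewrite linear0.
  have /memv_imgP [w _ ->] := usU k isT.
  by rewrite lfunE ffunE eq_sym neq_k.
apply: eq_bigr => i _ /=; apply: dim_limg_inj => u v; rewrite !lfunE.
by move=> /ffunP /(_ i); rewrite !ffunE eqxx.
Qed.
End ProductSpace.

Section Existence.
Variables (K : fieldType) (A : falgType K).
Implicit Types X Y : fgmodType A.
Variables (n : nat) (s : seq A).
Hypothesis s_idem : forall e, e \in s -> idempotent_elt e.

Local Notation a := (size s).
Local Notation b := (vbasis {:A}).
Local Notation e_ j := (nth 0 s j).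

Let e_idem (j : 'I_a) : idempotent_elt (e_ j).
Proof. by apply/s_idem/mem_nth. Qed.

Local Notation entry := ('I_n * 'I_a * 'I_(\dim {:A}))%type.

Let sum_e (f : A -> nat) : (\sum_(e <- s) f e = \sum_(j < a) f (e_ j))%N.
Proof. by rewrite (big_nth 0) big_mkord. Qed.

(** The maps Hom(P0, X) -> Hom(P1, X) given by the matrices with a single
    entry b_k e_j; they span the space of all maps P1 -> P0. *)
Lemma entry_maps X : exists h : entry ->
    'Hom({ffun 'I_a -> kmod X}, {ffun 'I_n -> kmod X}),
  forall k y, h k y = inj_at k.1.1 (act (b`_k.2 * e_ k.1.2) (y k.1.2)).
Proof.
have /choice [h hE] : forall k : entry,
    exists h : 'Hom({ffun 'I_a -> kmod X}, {ffun 'I_n -> kmod X}),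
    forall y, h y = inj_at k.1.1 (act (b`_k.2 * e_ k.1.2) (y k.1.2)).
  move=> k; have lin : linear (fun y : {ffun 'I_a -> kmod X} =>
      inj_at k.1.1 (act (b`_k.2 * e_ k.1.2) (y k.1.2)) : {ffun 'I_n -> kmod X}).
    by move=> c y z; rewrite !ffunE !linearP.
  by have [h hE] := linear_hom lin; exists h.
by exists h.
Qed.

Lemma act_basis X c (x : kmod X) : act c x = \sum_k coord b k c *: act b`_k x.
Proof.
rewrite {1}(coord_vbasis (memvf c)).
have ev_lin : linear (fun d : A => act d x) by move=> r d d'; rewrite actD actZ.
have [ev evE] := linear_hom ev_lin.
by rewrite -evE linear_sum; apply: eq_bigr => k _; rewrite linearZ /= evE.
Qed.

Lemma act_preimage_dim X (Z : {vspace kmod X}) e : idempotent_elt e -> stable Z ->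
  (\dim (lact X e @^-1: Z) + rank_at X e =
   \dim {:kmod X} + \dim (lact X e @: Z))%N.
Proof.
move=> ee stZ; rewrite -(limg_ker_dim (lact X e) (_ @^-1: _)).
rewrite -(limg_ker_dim (lact X e) fullv) capfv.
have -> : (lact X e @^-1: Z :&: lker (lact X e))%VS = lker (lact X e).
  by apply/capv_idPr; rewrite -lpreim0 lpreimS ?sub0v.
have -> : (lact X e @: (lact X e @^-1: Z))%VS = (lact X e @: Z)%VS.
  rewrite -lpreim_cap_limg lpreimK ?capvSr //; apply/vspaceP => x.
  by rewrite memv_cap mem_limg_idem // mem_act_idem.
by rewrite /rank_at addnAC.
Qed.

(** For a space S of tuples in N, the images of S under all maps P1 -> P0 fill
    Y^n, where Y is the submodule generated by the components of S, while S
    lies in the product of the e_j Y: negativity of the weight of Y is the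
    expansion property. Dually for M, with Z the largest submodule whose
    tuples lie in S and positivity of the weight of M / Z. The entries of F
    are combinations of the b_k e_j with coefficients in the blow-up matrices. *)
Lemma presentation_exists (M N : fgmodType A) :
  (forall (Q : fgmodType A) (p : {linear M -> Q}), surjective p -> ~ zero_module Q ->
     (n * \dim {:kmod Q} < \sum_(e <- s) rank_at Q e)%N) ->
  (forall (W : fgmodType A) (i : {linear W -> N}), injective i -> ~ zero_module W ->
     (\sum_(e <- s) rank_at W e < n * \dim {:kmod W})%N) ->
  exists L (F : 'I_L * 'I_n -> 'I_L * 'I_a -> A), [/\ (0 < L)%N,
    forall u v, F u v * e_ v.2 = F u v, solvable F M
  & separated F (fun v => e_ v.2) N].
Proof.
move=> posM negN; have [hN hNE] := entry_maps N; have [hM hME] := entry_maps M.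
have D_lin : linear (fun y : {ffun 'I_a -> kmod N} =>
    [ffun j : 'I_a => act (e_ j) (y j) - y j]).
  move=> c y z; apply/ffunP => j; rewrite !ffunE linearP scalerBr.
  by rewrite opprD addrACA.
have [Dmap DmapE] := linear_hom D_lin; pose D := lker Dmap.
have DP y : y \in D <-> forall j : 'I_a, act (e_ j) (y j) = y j.
  rewrite memv_ker DmapE; split=> [/eqP/ffunP y0 j|yE].
    by apply/eqP; rewrite -subr_eq0; have := y0 j; rewrite !ffunE => ->.
  by apply/eqP/ffunP => j; rewrite !ffunE yE subrr.
have [||L [T [L_gt0 sepT solT]]] :=
  @blowup_injective_surjective _ entry _ _ _ _ D hN hM.
- move=> S leSD S_neq0.
  have g_lin (k : 'I_a * 'I_(\dim {:A})) :
      linear (fun y : {ffun 'I_a -> kmod N} => act b`_k.2 (y k.1)).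
    by move=> c y z; rewrite !ffunE linearP.
  have /choice [g gE] : forall k : 'I_a * 'I_(\dim {:A}),
      exists g : 'Hom({ffun 'I_a -> kmod N}, kmod N),
      forall y, g y = act b`_k.2 (y k.1).
    by move=> k; have [g gE] := linear_hom (g_lin k); exists g.
  (* the submodule generated by the components of the tuples in S *)
  pose Y := (\sum_k g k @: S)%VS.
  have memY c (y : {ffun 'I_a -> kmod N}) j : y \in S -> act c (y j) \in Y.
    move=> yS; rewrite act_basis; apply: memv_suml => k _; apply: memvZ.
    apply: (subvP (sumv_sup (j, k) _ (subvv _))) => //.
    by apply/memv_imgP; exists y; rewrite ?gE.
  have stY : stable Y.
    move=> c _ /memv_sumP [w wS ->]; rewrite linear_sum; apply: memv_suml => k _.
    by have /memv_imgP [y yS ->] := wS k isT; rewrite gE /= -actM memY.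
  have memY1 (y : {ffun 'I_a -> kmod N}) j : y \in S -> y j \in Y.
    by move=> yS; rewrite -[y j]act1 memY.
  have [W [i [i_inj iY]]] := submodule_exists stY.
  have W_neq0 : ~ zero_module W.
    move=> W0; case/negP: S_neq0; rewrite -subv0; apply/subvP => y yS.
    rewrite memv0; apply/eqP/ffunP => j; rewrite ffunE.
    by have /iY [w <-] := memY1 y j yS; rewrite (W0 w) linear0.
  have rkW e : rank_at W e = \dim (lact N e @: Y).
    exact: rank_at_inj i_inj (limg_klin iY).
  have dimW : \dim {:kmod W} = \dim Y.
    by rewrite -rank_at1 rkW; congr (\dim _); apply/vspaceP => x;
       rewrite mem_act_idem /idempotent_elt ?mulr1 // act1 eqxx andbT.
  have := negN W i i_inj W_neq0; rewrite sum_e dimW => lt_nY.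
  apply: leq_ltn_trans (leq_trans lt_nY _).
    under eq_bigr => j _ do rewrite rkW.
    rewrite -dim_box; apply/dimvS/subvP => y yS; apply/mem_box => j.
    rewrite mem_act_idem // memY1 //=; apply/eqP; move: j; apply/DP.
    exact: (subvP leSD).
  have -> : (n * \dim Y)%N = \dim (box (fun _ : 'I_n => Y)).
    by rewrite dim_box sum_nat_const card_ord.
  apply/dimvS/subv_sumP => k _; rewrite limg_sum; apply/subv_sumP => jl _.
  apply: (sumv_sup (k, jl.1, jl.2)) => //.
  apply/subvP => _ /memv_imgP [_ /memv_imgP [y yS ->] ->].
  apply/memv_imgP; exists y => //.
  rewrite lfunE hNE gE /= actM; congr (inj_at _ (act _ _)).
  by apply/esym; move: (jl.1); apply/DP; apply: (subvP leSD).
- move=> S S_neq.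
  have k_lin (k : 'I_n * 'I_(\dim {:A})) :
      linear (fun z : kmod M => inj_at k.1 (act b`_k.2 z)).
    by move=> c y z; rewrite !linearP.
  have /choice [g gE] : forall k : 'I_n * 'I_(\dim {:A}),
      exists g : 'Hom(kmod M, {ffun 'I_n -> kmod M}),
      forall z, g z = inj_at k.1 (act b`_k.2 z).
    by move=> k; have [g gE] := linear_hom (k_lin k); exists g.
  (* the largest submodule such that all tuples in it lie in S *)
  pose Z := (\bigcap_k (g k @^-1: S))%VS.
  have memZ z : z \in Z <-> forall i c, inj_at i (act c z) \in S.
    split=> [zZ i c|zS].
      rewrite act_basis linear_sum; apply: memv_suml => k _.
      rewrite linearZ; apply: memvZ.
      move: zZ; rewrite memvE => /subv_bigcapP /(_ (i, k) isT).
      by rewrite -memvE -memv_preim gE.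
    rewrite memvE; apply/subv_bigcapP => k _; rewrite -memvE -memv_preim gE.
    exact: zS.
  have stZ : stable Z.
    by move=> c z /memZ zS; apply/memZ => i d; rewrite -actM zS.
  have nZ : (n * \dim Z <= \dim S)%N.
    have -> : (n * \dim Z)%N = \dim (box (fun _ : 'I_n => Z)).
      by rewrite dim_box sum_nat_const card_ord.
    apply/dimvS/subvP => y /mem_box yZ; rewrite (sum_inj_at y).
    apply: memv_suml => i _; rewrite -[y i]act1.
    by have /memZ := yZ i; apply.
  have [Q [p [p_surj pZ]]] := quotient_exists stZ.
  have Q_neq0 : ~ zero_module Q.
    move=> Q0; case/eqP: S_neq; apply/vspaceP => y; rewrite memvf (sum_inj_at y).
    apply: memv_suml => i _; rewrite -[y i]act1.
    by have /memZ : y i \in Z; [apply/pZ/Q0|apply].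
  have [Y [i [i_inj iZ]]] := submodule_exists stZ.
  have ip : short_exact i p by apply: short_exactI pZ.
  have rkM e : idempotent_elt e -> rank_at M e = (\dim (lact M e @: Z) + rank_at Q e)%N.
    by move=> ee; rewrite (rank_at_exact ip ee) (rank_at_inj e i_inj (limg_klin iZ)).
  have dimM : \dim {:kmod M} = (\dim Z + \dim {:kmod Q})%N.
    rewrite -!rank_at1 rkM /idempotent_elt ?mulr1 //; congr (\dim _ + _)%N.
    apply/vspaceP => x.
    by rewrite mem_act_idem /idempotent_elt ?mulr1 // act1 eqxx andbT.
  have dim_full m : \dim {:{ffun 'I_m -> kmod M}} = (m * \dim {:kmod M})%N.
    have <- : box (fun _ : 'I_m => {:kmod M}%VS) = fullv.
      by apply/vspaceP => y; rewrite memvf; apply/mem_box => k; apply: memvf.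
    by rewrite dim_box sum_nat_const card_ord.
  have -> : (\bigcap_k (hM k @^-1: S))%VS =
      box (fun j : 'I_a => (lact M (e_ j) @^-1: Z)%VS).
    apply/vspaceP => y; rewrite memvE; apply/subv_bigcapP/idP => [yS|/mem_box yZ k _].
      apply/mem_box => j; rewrite -memv_preim lactE.
      rewrite memvE; apply/subv_bigcapP => k _; rewrite -memvE -memv_preim gE.
      by have := yS (k.1, j, k.2) isT; rewrite -memvE -memv_preim hME /= actM.
    rewrite -memvE -memv_preim hME actM.
    by have := yZ k.1.2; rewrite -memv_preim lactE => /memZ.
  have := posM Q p p_surj Q_neq0; rewrite sum_e dim_box !dim_full => ltQ.
  have arith1 (x y z t : nat) : (x + (y + z) = t + y -> x + z = t)%N by lia.
  have arith2 (x y z t u : nat) :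
    (x < y -> z <= t -> z + x + u < u + y + t)%N by lia.
  have sum_pre : (\sum_(j < a) \dim (lact M (e_ j) @^-1: Z) +
      \sum_(j < a) rank_at Q (e_ j) = a * \dim {:kmod M})%N.
    rewrite -big_split /= -[X in (X * _)%N](card_ord a) -sum_nat_const.
    apply: eq_bigr => j _; have := act_preimage_dim (e_idem j) stZ.
    by rewrite rkM //; apply: arith1.
  have nM : (n * \dim {:kmod M} = n * \dim Z + n * \dim {:kmod Q})%N.
    by rewrite dimM mulnDr.
  rewrite nM -sum_pre; apply: arith2 ltQ nZ.
exists L, (fun u v => \sum_(k < \dim {:A}) T (u.2, v.2, k) u.1 v.1 *: (b`_k * e_ v.2)).
have sum_entry (U : nmodType) (G : entry -> U) :
    \sum_k G k = \sum_i \sum_j \sum_l G (i, j, l).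
  by rewrite !pair_bigA; apply: eq_bigr => -[[]].
have FmulE X (h : entry -> 'Hom({ffun 'I_a -> kmod X}, {ffun 'I_n -> kmod X}))
    (y : 'I_L -> {ffun 'I_a -> kmod X}) q i :
    (forall k y, h k y = inj_at k.1.1 (act (b`_k.2 * e_ k.1.2) (y k.1.2))) ->
    (\sum_p \sum_k T k q p *: h k (y p)) i =
    Fmul (fun u v => \sum_(k < \dim {:A}) T (u.2, v.2, k) u.1 v.1 *: (b`_k * e_ v.2))
      (fun v => y v.1 v.2) (q, i).
  move=> hE; rewrite sum_ffunE /Fmul -(pair_bigA _ (fun p j =>
    act (\sum_(k < \dim {:A}) T (i, j, k) q p *: (b`_k * e_ j)) (y p j))) /=.
  apply: eq_bigr => p _; rewrite sum_ffunE sum_entry.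
  rewrite (bigD1 i) //= [X in _ + X]big1 ?addr0 => [|i' neq_i].
    apply: eq_bigr => j _.
    have ev_lin : linear (fun d : A => act d (y p j)).
      by move=> r d d'; rewrite actD actZ.
    have [ev evE] := linear_hom ev_lin; rewrite -evE linear_sum.
    by apply: eq_bigr => k _; rewrite ffunE hE ffunE eqxx linearZ /= evE.
  apply: big1 => j _; apply: big1 => k _; rewrite ffunE hE ffunE.
  by rewrite eq_sym (negPf neq_i) scaler0.
split=> //.
- move=> u v; rewrite mulr_suml; apply: eq_bigr => k _.
  by rewrite -scalerAl -mulrA e_idem.
- move=> x; have [y yE] := solT (fun q => [ffun i => x (q, i)]).
  exists (fun v => y v.1 v.2) => -[q i]; rewrite -(FmulE M hM y q i hME).
  by rewrite -yE ffunE.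
move=> y Ey Fy [p j].
pose y' q : {ffun 'I_a -> kmod N} := [ffun k => y (q, k)].
have /ffunP/(_ j) : y' p = 0; last by rewrite !ffunE.
apply: sepT => [q|q]; first by apply/DP => k; rewrite !ffunE (Ey (q, k)).
apply/ffunP => i; rewrite (FmulE N hN y' q i hNE) ffunE -[RHS](Fy (q, i)).
by apply: eq_bigr => -[r k] _ /=; rewrite ffunE.
Qed.

(** On such a module F induces an isomorphism from Hom(P0, X) to Hom(P1, X). *)
Lemma solvable_separated_rank L (F : 'I_L * 'I_n -> 'I_L * 'I_a -> A) X :
  (forall u v, F u v * e_ v.2 = F u v) ->
  solvable F X -> separated F (fun v => e_ v.2) X ->
  (L * (\sum_(e <- s) rank_at X e) = L * (n * \dim {:kmod X}))%N.
Proof.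
move=> FE solX sepX.
pose D := box (fun v : 'I_L * 'I_a => limg (lact X (e_ v.2))).
have lin : linear (fun y : {ffun 'I_L * 'I_a -> kmod X} =>
    [ffun u : 'I_L * 'I_n => Fmul F y u]).
  move=> c y z; apply/ffunP => u; rewrite !ffunE scaler_sumr -big_split.
  by apply: eq_bigr => v _; rewrite !ffunE linearP.
have [f fE] := linear_hom lin.
have DP (y : {ffun 'I_L * 'I_a -> kmod X}) :
    y \in D <-> forall v : 'I_L * 'I_a, act (e_ v.2) (y v) = y v.
  split=> [/mem_box yD v|yE]; first by have := yD v; rewrite mem_limg_idem // => /eqP.
  by apply/mem_box => v; rewrite mem_limg_idem //; apply/eqP.
have fD : (f @: D)%VS = fullv.
  apply/vspaceP => x; rewrite memvf; have [y yE] := solX x.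
  apply/memv_imgP; exists [ffun v : 'I_L * 'I_a => act (e_ v.2) (y v)].
    by apply/DP => v; rewrite ffunE -actM e_idem.
  rewrite fE; apply/ffunP => u; rewrite ffunE yE.
  by apply: eq_bigr => v _; rewrite ffunE -actM FE.
have kD : (D :&: lker f = 0)%VS.
  apply/eqP; rewrite -subv0; apply/subvP => y; rewrite memv_cap memv_ker fE.
  move=> /andP[/DP yD /eqP/ffunP y0]; rewrite memv0; apply/eqP/ffunP => v.
  rewrite [RHS]ffunE; apply: sepX => // u; by have := y0 u; rewrite !ffunE.
have := limg_dim_eq kD; rewrite fD dim_box.
have <- : box (fun _ : 'I_L * 'I_n => {:kmod X}%VS) = fullv.
  by apply/vspaceP => y; rewrite memvf; apply/mem_box => k; apply: memvf.
rewrite dim_box sum_nat_const card_prod !card_ord -mulnA => ->.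
rewrite -(pair_bigA _ (fun (p : 'I_L) (j : 'I_a) => rank_at X (e_ j))) /=.
by rewrite sum_e sum_nat_const card_ord.
Qed.

End Existence.

(** * Bicompact numerically disjoint torsion classes *)

Theorem theorem1p5 (K : fieldType) (A : falgType K) (T : subcategory A)
    (T_torsion : torsion_class T) (T_bicompact : bicompact_torsion T)
    (T_disjoint : numerically_disjoint T) :
  functorially_finite T.
Proof.
have [[M TM] [N FN]] := T_bicompact.
have T_M : T M by apply/TM.
have F_N : right_perp T N by apply/FN.
have F_class := right_perp_torsion_free T.
have [n [s [s_idem posM negN]]] :=
  numerical_separation T_torsion T_M F_N T_disjoint F_class.
have [L [F [L_gt0 FE solM sepN]]] := presentation_exists s_idem posM negN.
pose E (v : 'I_L * 'I_(size s)) := nth 0 s v.2.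
have E_idem v : idempotent_elt (E v) by apply/s_idem/mem_nth.
have sepF Y : right_perp T Y -> separated F E Y.
  by move=> /FN; apply=> //; apply: separated_torsion_free.
have negF Y : right_perp T Y -> ~ zero_module Y ->
    (\sum_(e <- s) rank_at Y e < n * \dim {:kmod Y})%N.
  move=> /FN FY; apply: (FY _ (negative_weight_torsion_free n s_idem) negN Y idfun).
  by move=> x y.
have solT X : T X -> solvable F X.
  by move=> /TM; apply=> //; apply: solvable_torsion.
have zero_of Y : right_perp T Y -> solvable F Y -> zero_module Y.
  move=> FY solY; apply: contrapT => Y_neq0; have := negF Y FY Y_neq0.
  suff -> : (\sum_(e <- s) rank_at Y e = n * \dim {:kmod Y})%N by rewrite ltnn.
  apply/eqP; rewrite -(eqn_pmul2l L_gt0); apply/eqP.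
  exact: solvable_separated_rank FE solY (sepF Y FY).
have T_solvable X : T X <-> solvable F X.
  split=> [/solT//|solX].
  apply: (torsion_of_no_quotient T_torsion) => Y q q_surj FY.
  apply: zero_of => //; have [_ _ quo _] := solvable_torsion F.
  exact: quo q_surj solX.
move=> X; split.
  exact: (left_approximation_exists E_idem FE T_torsion T_solvable sepF X).
exact: right_approximation_exists T_torsion X.
Qed.
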